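(* With high probability, $Q^n(2)$ contains a unique giant component, and it spans all but $o(2^n)$ vertices. That is, there is a sequence $\varepsilon_n\to 0$ such that, with probability tending to $1$ as $n\to\infty$, $Q^n(2)$ has a connected component with at least $(1-\varepsilon_n)2^n$ vertices; and for every fixed $\delta\in(0,1)$, with probability tending to $1$ as $n\to\infty$, exactly one connected component of $Q^n(2)$ has at least $\delta 2^n$ vertices.
   Context: $Q^n$ is the $n$-dimensional cube: the graph with vertex set $V=\{0,1\}^n$ in which two vertices are adjacent iff they differ in precisely one coordinate. For an integer $1\le k\le n-1$, $Q^n(k)$ (the $k$-out model) is the random (simple, undirected) spanning subgraph of $Q^n$ with vertex set $V$ obtained as follows: independently for every $v\in V$, choose a set of $k$ distinct edges uniformly from all the $\binom{n}{k}$ sets of $k$ distinct edges of $Q^n$ incident to $v$; the edge set of $Q^n(k)$ is the union of all chosen sets. A giant component is a connected component spanning $\Omega(2^n)$ vertices. A sequence of events holds with high probability (w.h.p.) if its probability tends to $1$ as $n\to\infty$. *)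

(* Defs.v *)
From HB Require Import structures.
From mathcomp Require Import all_boot all_order all_algebra.
From mathcomp Require Import all_classical all_reals all_analysis.

Set Implicit Arguments.
Unset Strict Implicit.
Unset Printing Implicit Defensive.

Import Order.TTheory GRing.Theory Num.Theory.
Import numFieldNormedType.Exports.

Local Open Scope ring_scope.

Definition cube (n : nat) : finType := {ffun 'I_n -> bool}.

Definition cube_adj (n : nat) : rel (cube n) :=
  fun x y => #|[set i | x i != y i]| == 1%N.

(* An undirected edge is the two-element set of its endpoints. *)
Definition cube_edges (n : nat) : {set {set cube n}} :=
  [set e : {set cube n} |
    [exists x, exists y, cube_adj x y && (e == [set x; y])]].

Definition incident_edges (n : nat) (v : cube n) : {set {set cube n}} :=
  [set e in cube_edges n | v \in e].

Definition choices (n k : nat) (v : cube n) : {set {set {set cube n}}} :=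
  [set S : {set {set cube n}} | (S \subset incident_edges v) && (#|S| == k)].

Definition uniform_mass (R : realType) (T : finType) (A : {set T}) (x : T) : R :=
  (x \in A)%:R / #|A|%:R.

(* An outcome records the set of edges chosen at each vertex. *)
Definition outcome (n : nat) : finType := {ffun cube n -> {set {set cube n}}}.

(* Product mass: the choices at distinct vertices are independent.  Outcomes
   that are not families of k-sets of incident edges have mass 0, and the total
   mass is 1 when k <= n (for k > n there are no admissible outcomes and every
   mass is 0). *)
Definition kout_mass (R : realType) (n k : nat) (w : outcome n) : R :=
  \prod_(v : cube n) uniform_mass R (choices k v) (w v).

Definition kout_prob (R : realType) (n k : nat) (E : pred (outcome n)) : R :=
  \sum_(w : outcome n | E w) kout_mass R k w.

Definition kout_edges (n : nat) (w : outcome n) : {set {set cube n}} :=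
  (\bigcup_(v : cube n) w v)%SET.

Definition kout_adj (n : nat) (w : outcome n) : rel (cube n) :=
  fun x y => (x != y) && ([set x; y]%SET \in kout_edges w).

Definition components (T : finType) (e : rel T) : {set {set T}} :=
  [set [set y | connect e x y] | x : T].

Definition whp_kout (R : realType) (k : nat)
    (E : forall n : nat, pred (outcome n)) : Prop :=
  ((fun n : nat => kout_prob R k (@E n)) @ \oo --> (1 : R))%classic.

(* Main.v *)
Require Import Defs.
From HB Require Import structures.
From mathcomp Require Import all_boot all_order all_algebra.
From mathcomp Require Import all_classical all_reals all_analysis.
From mathcomp Require Import ring lra zify.

(** Expose the choices in two stages. Stage 1 reveals both choices of every
    even vertex and the first choice of every odd vertex. Every component of the
    resulting graph contains an even vertex x together with the set reached from
    x along revealed choices. If that set has e even and o odd vertices, then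
    o <= 2e and, of the 2e + o choices made in it, only e + o - 1 discover a new
    vertex; the other e + 1 hit vertices already discovered, and a choice of y
    does so with probability deg(y) / n, where deg counts the discovered
    neighbours of y. These degrees are below a small multiple of n
    except at boundedly many vertices, because two vertices of the cube share at
    most two neighbours. Hence x reaches fewer than K n even vertices with
    probability O(1 / n^2), and w.h.p. there are at most 2 * 2^n / (K n)
    stage-1 components.

    Stage 2 reveals the second choices of the odd vertices. The cube is
    bipartite, so each of the at least |A||~A| / 2^n edges leaving a set A has
    an odd endpoint, and A stays separated from its complement with probability
    at most exp (- |A||~A| / (2^n n)). For a balanced union A of stage-1
    components this beats the number 2^(2 * 2^n / (K n)) of such unions once K
    is large. So no balanced cut survives, which forces a giant component. *)

Set Implicit Arguments.
Unset Strict Implicit.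
Unset Printing Implicit Defensive.

Import Order.TTheory GRing.Theory Num.Theory.
Import numFieldNormedType.Exports.

Local Open Scope ring_scope.

(** * Geometry of the cube *)

Section Cube.
Variable n : nat.
Implicit Types (x y z v : cube n) (i j k : 'I_n) (U A : {set cube n}).

Definition flip v i : cube n := [ffun k => v k (+) (k == i)].

Lemma flipE v i k : flip v i k = v k (+) (k == i).
Proof. by rewrite ffunE. Qed.

Lemma flipK i : involutive (fun v => flip v i).
Proof. by move=> v; apply/ffunP => k; rewrite !flipE addbK. Qed.

Lemma flip_neq v i k : (flip v i k != v k) = (k == i).
Proof. by rewrite flipE; case: (v k); case: (k == i). Qed.

Lemma flip_inj v : injective (flip v).
Proof.
move=> i j eq_ij; apply/eqP.
by rewrite -(flip_neq v j i) -eq_ij flip_neq.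
Qed.

Lemma flipN v i : flip v i != v.
Proof. by apply/eqP => /ffunP/(_ i)/eqP; apply/negP; rewrite flip_neq. Qed.

Lemma cube_adjP x y : reflect (exists i, y = flip x i) (cube_adj x y).
Proof.
apply: (iffP cards1P) => [[i def_i]|[i ->]]; exists i.
  apply/ffunP => k; move/setP/(_ k): def_i; rewrite flipE !inE => <-.
  by case: (x k); case: (y k).
by apply/setP => k; rewrite !inE eq_sym flip_neq.
Qed.

Lemma cube_adj_flip x i : cube_adj x (flip x i).
Proof. by apply/cube_adjP; exists i. Qed.

Definition par v : bool := \big[addb/false]_i v i.

Lemma par_flip v i : par (flip v i) = ~~ par v.
Proof.
rewrite /par (eq_bigr (fun k => v k (+) (k == i))) => [|k _]; last exact: flipE.
rewrite big_split /= (bigD1 (P := xpredT) i) //= (bigD1 (P := xpredT) i) //=.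
rewrite eqxx [X in _ (+) (true (+) X)]big1 => [|k /negbTE->] //.
by rewrite addbF addbT.
Qed.

(* A common neighbour of two distinct vertices flips one of the at most two
   coordinates where they differ. *)
Lemma common_neighbours x y : x != y ->
  (#|[set z | (z \in codom (flip x)) && (z \in codom (flip y))]| <= 2)%N.
Proof.
move=> xNy; set Z := [set z | _].
have [->|[z0]] := set_0Vmem Z; first by rewrite cards0.
rewrite inE => /andP[/codomP[i0 ->] /codomP[k0 e0]].
suff sZ : Z \subset [set flip x i0; flip x k0].
  by rewrite (leq_trans (subset_leq_card sZ)) // cards2; case: (_ != _).
apply/fintype.subsetP => z; rewrite inE => /andP[/codomP[i ->] /codomP[k e]].
rewrite !inE !(inj_eq (@flip_inj _)); apply: contraNT xNy.
rewrite negb_or => /andP[/negbTE iNi0 /negbTE iNk0].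
(* At coordinate [i], [e0] says that [x] and [y] agree, so [e] forces [k = i], whence [x = y]. *)
have eki : k = i.
  move/ffunP/(_ i): e; move/ffunP/(_ i): e0.
  rewrite !flipE eqxx iNi0 iNk0; case: (x i); case: (y i); case: eqP => //=.
by rewrite -(inj_eq (can_inj (flipK i))) e eki.
Qed.

Definition deg_in U y : nat := #|[set i | flip y i \in U]|.

Lemma deg_in_le_card U y : (deg_in U y <= #|U|)%N.
Proof.
rewrite /deg_in -(card_imset _ (@flip_inj y)) subset_leq_card //.
by apply/fintype.subsetP => z /imsetP[i]; rewrite inE => ? ->.
Qed.

Lemma deg_inS U U' y : U \subset U' -> (deg_in U y <= deg_in U' y)%N.
Proof.
move=> sUU'; rewrite subset_leq_card //; apply/fintype.subsetP => i.
by rewrite !inE => /(fintype.subsetP sUU').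
Qed.

(* Bonferroni: two distinct neighbourhoods share at most two vertices. *)
Lemma sum_deg_in (U Y : {set cube n}) :
  (\sum_(y in Y) deg_in U y <= #|U| + 2 * #|Y| ^ 2)%N.
Proof.
pose c z : nat := (\sum_(y in Y) (z \in codom (flip y)))%N.
have -> : (\sum_(y in Y) deg_in U y = \sum_(z in U) c z)%N.
  rewrite exchange_big /=; apply: eq_bigr => y _.
  rewrite /deg_in -(card_imset _ (@flip_inj y)) -sum1_card.
  rewrite [RHS]big_mkcond [LHS]big_mkcond /=; apply: eq_bigr => z _.
  case: (boolP (z \in U)) => zU; last first.
    by case: imsetP => // -[i]; rewrite inE => zU' e; rewrite e zU' in zU.
  case: codomP => [[i e]|zN]; first by rewrite e imset_f // inE -e.
  by case: imsetP => // -[i _ e]; case: zN; exists i.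
have c_le z : (c z <= 1 + \sum_(y in Y) \sum_(y' in Y | y' != y)
    ((z \in codom (flip y)) && (z \in codom (flip y'))))%N.
  have [[y0 y0Y zy0]|zN] := pselect (exists2 y, y \in Y & z \in codom (flip y)); last first.
    rewrite [c z]big1 // => y yY; apply/eqP; rewrite eqb0.
    by apply/negP => zy; apply: zN; exists y.
  (* The row of [y0] in the double sum already counts every other member of [Y] adjacent to [z]. *)
  rewrite /c (bigD1 y0) //= zy0 leq_add2l [leqRHS](bigD1 y0) //=.
  rewrite (leq_trans _ (leq_addr _ _)) //.
  by apply: leq_sum => y _; rewrite zy0.
have {}c_le : (\sum_(z in U) c z <= \sum_(z in U) (1 + \sum_(y in Y) \sum_(y' in Y | y' != y)
    ((z \in codom (flip y)) && (z \in codom (flip y')))))%N.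
  by apply: leq_sum => z _; exact: c_le.
apply: leq_trans c_le _.
rewrite big_split /= sum1_card leq_add2l exchange_big /=.
apply: (@leq_trans (\sum_(y in Y) \sum_(y' in Y) 2)%N); last first.
  by rewrite !sum_nat_const mulnA mulnn mulnC.
apply: leq_sum => y yY; rewrite exchange_big /= big_mkcondr /=.
apply: leq_sum => y' y'Y; case: ifP => // y'Ny.
rewrite eq_sym in y'Ny; apply: leq_trans (common_neighbours y'Ny).
rewrite -sum1_card big_mkcond [leqRHS]big_mkcond /=; apply: leq_sum => z _.
by rewrite inE; case: (z \in U); case: (_ && _).
Qed.

(** Otherwise [r.+1] such vertices would have total degree at least [r.+1 * b], above the bound of
    [sum_deg_in]. *)
Lemma few_bad (U : {set cube n}) (b r s : nat) :
    (#|U| <= s)%N -> (s + 2 * r.+1 ^ 2 < r.+1 * b)%N ->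
  (#|[set y | (b <= deg_in U y)%N]| <= r)%N.
Proof.
move=> leUs sr; rewrite leqNgt; apply/negP => /card_geqP[l [l_uniq l_size l_sub]].
have := sum_deg_in U [set y in l].
have card_l : #|[set y in l]| = r.+1 by rewrite cardsE (card_uniqP l_uniq).
have : (\sum_(y in [set y in l]) b <= \sum_(y in [set y in l]) deg_in U y)%N.
  by apply: leq_sum => y; rewrite inE => /l_sub; rewrite inE.
by rewrite sum_nat_const card_l; lia.
Qed.

End Cube.

(** * Uniform measures *)

Section Probability.
Variable R : realType.

Definition pr (O : finType) (E : pred O) : R := #|[set w | E w]|%:R / #|O|%:R.

Lemma pr_ge0 (O : finType) (E : pred O) : 0 <= pr E.
Proof. by rewrite /pr divr_ge0. Qed.

Lemma pr_le1 (O : finType) (E : pred O) : pr E <= 1.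
Proof.
rewrite /pr; have [->|O_gt0] := posnP #|O|; first by rewrite invr0 mulr0.
by rewrite ler_pdivrMr ?ltr0n // mul1r ler_nat max_card.
Qed.

Lemma pr_sub (O : finType) (E F : pred O) : subpred E F -> pr E <= pr F.
Proof.
move=> sEF; rewrite /pr ler_wpM2r // ler_nat subset_leq_card //.
by apply/fintype.subsetP => w; rewrite !inE; exact: sEF.
Qed.

Lemma pr_pred0 (O : finType) (E : pred O) : (forall w, ~~ E w) -> pr E = 0.
Proof.
move=> nE; rewrite /pr (_ : [set w | E w] = finset.set0) ?cards0 ?mul0r //.
by apply/setP => w; rewrite !inE (negbTE (nE w)).
Qed.

Lemma pr_sum_ord (O : finType) (m : nat) (f : O -> nat) :
  pr (fun w => f w < m)%N = \sum_(e < m) pr (fun w => f w == e).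
Proof.
rewrite /pr -mulr_suml -natr_sum; congr (_%:R / _).
under eq_bigr do rewrite -sum1_card big_mkcond /=.
rewrite exchange_big /= -sum1_card big_mkcond /=; apply: eq_bigr => w _.
rewrite !inE; case: ltnP => fm.
  rewrite (bigD1 (Ordinal fm)) //= inE eqxx big1 // => i iN.
  by rewrite inE; case: eqP => // e; case/eqP: iN; apply: val_inj.
by rewrite big1 // => i _; rewrite inE gtn_eqF // (leq_trans _ fm).
Qed.

(* Revealing the single coordinate [y]: given its value [t], the event is
   controlled by one that no longer depends on that coordinate. *)
Lemma pr_reveal (V T : finType) (y : V) (E : pred {ffun V -> T})
    (F : T -> pred {ffun V -> T}) :
    (forall w, E w -> F (w y) w) ->
    (forall t (w w' : {ffun V -> T}), {in predC1 y, w =1 w'} -> F t w = F t w') ->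
  pr E <= (\sum_t pr (F t)) / #|T|%:R.
Proof.
move=> EF Find; have [T0|T_gt0] := posnP #|T|.
  rewrite pr_pred0 => [|w]; last by have := card0_eq T0 (w y).
  by rewrite divr_ge0 // sumr_ge0 // => t _; exact: pr_ge0.
rewrite /pr -mulr_suml mulrAC ler_wpM2r //.
rewrite ler_pdivlMr ?ltr0n // -natr_sum -natrM ler_nat.
(* [g] exchanges the coordinate [w y] with a fresh value [t]. It is injective and maps pairs with
   [E w] to pairs counted by [F]. *)
pose upd (w : {ffun V -> T}) t : {ffun V -> T} := [ffun v => if v == y then t else w v].
pose g (p : {ffun V -> T} * T) := (p.1 y, upd p.1 p.2).
have g_inj : injective g.
  case=> w t [w' t'] [/= ewy /ffunP eu].
  have := eu y; rewrite !ffunE eqxx => ->; congr (_, _).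
  by apply/ffunP => v; have := eu v; rewrite !ffunE; case: eqP => // ->.
have -> : (\sum_t #|[set w | F t w]|)%N = #|[set p : T * {ffun V -> T} | F p.1 p.2]|.
  have cF t : #|[set w | F t w]| = (\sum_w F t w)%N.
    by rewrite -sum1_card big_mkcond /=; apply: eq_bigr => w _; rewrite inE; case: (F t w).
  rewrite (eq_bigr _ (fun t _ => cF t)) pair_bigA -sum1_card [RHS]big_mkcond /=.
  by apply: eq_bigr => p _; rewrite inE; case: (F p.1 p.2).
rewrite -cardsT -cardsX -(card_imset _ g_inj) subset_leq_card //.
apply/fintype.subsetP => p /imsetP[[w t]]; rewrite !inE /= andbT => Ew ->.
rewrite /= -(Find _ w); first exact: EF.
by move=> v; rewrite !inE ffunE => /negbTE->.
Qed.

Lemma pr_markov (O : finType) (f : O -> nat) (c M : R) : 0 < c ->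
  (\sum_w (f w)%:R) / #|O|%:R <= M -> pr (fun w => c <= (f w)%:R) <= M / c.
Proof.
move=> c0 leM; rewrite ler_pdivlMr // (le_trans _ leM) //.
rewrite /pr mulrAC ler_wpM2r // -sum1_card natr_sum mulr_suml.
rewrite [leRHS](bigID (fun w => c <= (f w)%:R)) /=.
rewrite (eq_bigl (fun w => c <= (f w)%:R)) => [|w]; last by rewrite !inE.
rewrite ler_wpDr ?sumr_ge0 // ler_sum // => w; by rewrite mul1r.
Qed.

Lemma sum_card_pr (O V : finType) (E : O -> pred V) (D : pred V) :
  (\sum_w (#|[set v | D v && E w v]|)%:R) / #|O|%:R = \sum_(v | D v) pr (E ^~ v).
Proof.
rewrite /pr -mulr_suml -!natr_sum; congr (_%:R / _).
under eq_bigr do rewrite -sum1_card big_mkcond /=.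
rewrite exchange_big [RHS]big_mkcond /=; apply: eq_bigr => v _.
case: (boolP (D v)) => Dv.
  by rewrite -sum1_card [RHS]big_mkcond; apply: eq_bigr => w _; rewrite !inE Dv.
by rewrite big1 // => w _; rewrite inE (negbTE Dv).
Qed.

End Probability.

(** * Exploration *)

Section Reach.
Variable V : finType.
Implicit Types (N : V -> {set V}) (P U S : {set V}).

Definition closed_off N P S := [forall v, (v \in S :\: P) ==> (N v \subset S)].

(* The vertices reached from [U] when the vertices of [P] are not expanded. *)
Definition reach N P U : {set V} :=
  [set z | [forall S : {set V}, (U \subset S) && closed_off N P S ==> (z \in S)]].

Lemma closed_offP N P S :
  reflect (forall v, v \in S -> v \notin P -> N v \subset S) (closed_off N P S).
Proof.
apply: (iffP forallP) => [cS v vS vP|cS v].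
  by have := cS v; rewrite inE vS vP.
by apply/implyP; rewrite inE => /andP[vP vS]; exact: cS.
Qed.

Lemma sub_reach N P U : U \subset reach N P U.
Proof.
apply/fintype.subsetP => z zU; rewrite inE; apply/forallP => S.
by apply/implyP => /andP[/fintype.subsetP sUS _]; exact: sUS.
Qed.

Lemma reach_min N P U S : U \subset S -> closed_off N P S -> reach N P U \subset S.
Proof.
move=> US cS; apply/fintype.subsetP => z; rewrite inE => /forallP/(_ S).
by rewrite US cS.
Qed.

Lemma reach_id N P : reach N P P = P.
Proof.
apply/eqP; rewrite finset.eqEsubset sub_reach andbT reach_min //.
by apply/closed_offP => v ->.
Qed.

(** A set containing [U] and closed outside [P] contains [N y], so both sides intersect the same
    family of sets. *)
Lemma reach_step N P U y : y \in U -> y \notin P ->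
  reach N P U = reach N (y |: P) (U :|: N y).
Proof.
move=> yU yP; apply/setP => z; rewrite !inE; apply: eq_forallb => S.
congr (_ ==> _); apply/andP/andP => -[sU /closed_offP cS].
  have yS := fintype.subsetP sU _ yU.
  split; first by rewrite finset.subUset sU cS.
  by apply/closed_offP => v vS; rewrite !inE negb_or => /andP[_]; exact: cS.
move: sU; rewrite finset.subUset => /andP[sU sN]; split=> //.
apply/closed_offP => v vS vP; have [->//|vy] := eqVneq v y.
by apply: cS => //; rewrite !inE negb_or vy.
Qed.

(** This provides the independence from processed vertices that [pr_reveal] asks for. *)
Lemma eq_reach N N' P U : (forall v, v \notin P -> N v = N' v) ->
  reach N P U = reach N' P U.
Proof.
move=> eN; apply/setP => z; rewrite !inE; apply: eq_forallb => S.
congr (_ && _ ==> _); apply: eq_forallb => v; rewrite !inE.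
by case: (boolP (v \in P)) => //= vP; rewrite eN.
Qed.

End Reach.

Section Exploration.
Variables (R : realType) (n : nat).
Hypothesis n_gt1 : (1 < n)%N.
Implicit Types (v y : cube n) (i k : 'I_n) (U P S A : {set cube n}).

(** Through [lift], a uniform [t] encodes a uniform ordered pair of distinct directions. Odd
    vertices show only the first one in stage 1. *)
Definition picks (t : 'I_n * 'I_n.-1) v : {set cube n} :=
  if par v then [set flip v t.1] else [set flip v t.1; flip v (lift t.1 t.2)].

Definition stage1 (w : {ffun cube n -> 'I_n * 'I_n.-1}) v := picks (w v) v.

Definition evens S : {set cube n} := [set v in S | ~~ par v].
Definition odds S : {set cube n} := [set v in S | par v].

Lemma card_evens_odds S : #|S| = (#|evens S| + #|odds S|)%N.
Proof.
rewrite -(cardsID [set v | par v] S) addnC; congr (_ + _)%N.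
  by congr #|pred_of_set _|; apply/setP => v; rewrite !inE andbC.
by congr #|pred_of_set _|; apply/setP => v; rewrite !inE.
Qed.

Lemma evensS U S : U \subset S -> (#|evens U| <= #|evens S|)%N.
Proof.
move=> sUS; rewrite subset_leq_card //; apply/fintype.subsetP => v.
by rewrite !inE => /andP[/(fintype.subsetP sUS)->].
Qed.

Lemma sum_lift (a : 'I_n -> R) i : \sum_j a (lift i j) = \sum_k a k - a i.
Proof. by rewrite [in RHS](bigD1_ord i) //= addrAC subrr add0r. Qed.

Lemma sum_pick1 (a : 'I_n -> R) :
  \sum_(t : 'I_n * 'I_n.-1) a t.1 = n.-1%:R * \sum_i a i.
Proof.
rewrite -(pair_bigA _ (fun i _ => a i)) mulr_sumr /=; apply: eq_bigr => i _.
by rewrite sumr_const card_ord mulr_natl.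
Qed.

Lemma sum_pick2 (a : 'I_n -> R) :
  \sum_(t : 'I_n * 'I_n.-1) a t.1 * a (lift t.1 t.2) =
  (\sum_i a i) ^+ 2 - \sum_i a i ^+ 2.
Proof.
rewrite -(pair_bigA _ (fun i j => a i * a (lift i j))) /=.
rewrite expr2 mulr_suml -sumrB; apply: eq_bigr => i _.
by rewrite -mulr_sumr sum_lift mulrBr expr2.
Qed.

(** Cauchy-Schwarz, by expanding the sum of the squares of [n * a i - s]. *)
Lemma sum_sqr (a : 'I_n -> R) :
  (\sum_i a i) ^+ 2 <= n%:R * \sum_i a i ^+ 2.
Proof.
have n0 : (0 : R) < n%:R by rewrite ltr0n ltnW.
set s := \sum_i a i; set q := \sum_i a i ^+ 2.
have : 0 <= \sum_i (n%:R * a i - s) ^+ 2 by rewrite sumr_ge0 // => i _; exact: sqr_ge0.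
rewrite (eq_bigr (fun i => n%:R ^+ 2 * a i ^+ 2 + (- (2 * n%:R * s) * a i + s ^+ 2)));
  last by move=> i _; ring.
rewrite !big_split /= -!mulr_sumr sumr_const card_ord -/q -/s.
rewrite -[s *+ n]mulr_natl => h.
have : 0 <= n%:R * (n%:R * q - s ^+ 2).
  by rewrite (_ : _ * _ = n%:R ^+ 2 * q + (- (2 * n%:R * s) * s + s * (n%:R * s))) //; ring.
by rewrite pmulr_rge0 // subr_ge0.
Qed.

Lemma card_pick : #|{: 'I_n * 'I_n.-1}|%:R = n%:R * (n%:R - 1) :> R.
Proof. by rewrite card_prod !card_ord natrM -subn1 natrB ?(ltnW n_gt1). Qed.

(** * Potential bound for reaching exactly [e] even vertices *)

Section Bound.
Variables (rho : R) (b r e : nat).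
Hypotheses (rho_gt0 : 0 < rho) (rho_le : rho <= 2^-1) (b_le : b%:R <= rho * n%:R).
Hypothesis few : forall U, (#|U| <= 3 * e)%N ->
  (#|[set y | (b < deg_in U y)%N]| <= r)%N.

Definition bad P U := [set y in P | (b < deg_in U y)%N].

(* The potential of a state with processed vertices [P] and discovered vertices
   [U]. A pick at a vertex with few discovered neighbours falls into [U] with
   probability at most [rho], and the process can only stop at [e] even
   vertices after at least [#|U :\: P| + (e - #|evens P|)] such picks. *)
Definition potential P U : R :=
  rho ^+ (#|U :\: P| + (e - #|evens P|)) * 2 ^+ #|odds (U :\: P)| *
  9 ^+ (e - #|evens P|) * rho^-1 ^+ (2 * (r - #|bad P U|)).

(** Up to the constants in [weight], a pick multiplies the potential by [rho^-1] when it hits [U],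
    and by [c] when it discovers a vertex: 1 for an even one, 2 for an odd one because of the factor
    [2 ^+ #|odds _|]. *)
Definition gain (c : R) U y i : R := if flip y i \in U then rho^-1 else c.

Lemma rhoV_ge2 : 2 <= rho^-1.
Proof. by rewrite -[leLHS]invrK lef_pV2 ?posrE ?invr_gt0. Qed.

Lemma potential_ge0 P U : 0 <= potential P U.
Proof. by rewrite /potential !mulr_ge0 ?exprn_ge0 ?invr_ge0 // ltW. Qed.

Lemma gain_ge0 c U y i : 0 <= c -> 0 <= gain c U y i.
Proof. by move=> c0; rewrite /gain; case: ifP => // _; rewrite invr_ge0 ltW. Qed.

Lemma gain_le c U y i : c <= 2 -> gain c U y i <= rho^-1.
Proof. by move=> c2; rewrite /gain; case: ifP => // _; rewrite (le_trans c2) // rhoV_ge2. Qed.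

(** At most [b <= rho * n] directions hit [U] and contribute at most [n] in all; the others
    contribute at most [c * n]. *)
Lemma sum_gain c U y : 0 <= c -> (deg_in U y <= b)%N ->
  \sum_i gain c U y i <= (1 + c) * n%:R.
Proof.
move=> c0 deg_le; rewrite (bigID (fun i => flip y i \in U)) /= mulrDl mul1r lerD //.
  rewrite (eq_bigr (fun=> rho^-1)) => [|i iU]; last by rewrite /gain iU.
  rewrite sumr_const -[leLHS]mulr_natl ler_pdivrMr // mulrC (le_trans _ b_le) // ler_nat.
  by rewrite (leq_trans _ deg_le) // /deg_in cardsE.
rewrite (eq_bigr (fun=> c)) => [|i iU]; last by rewrite /gain (negbTE iU).
by rewrite sumr_const -[leLHS]mulr_natr ler_wpM2l // ler_nat -[leqRHS]card_ord max_card.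
Qed.

(** The normalisations come from [sum_gain]: [2 = 1 + 1] for one pick, [9 = (1 + 2) ^ 2] for two. A
    vertex of high degree is paid for by [rho ^+ 2], enough for two hits. *)
Definition weight U y (t : 'I_n * 'I_n.-1) : R :=
  (if par y then 2^-1 * gain 1 U y t.1
   else 9^-1 * (gain 2 U y t.1 * gain 2 U y (lift t.1 t.2))) *
  (if (b < deg_in U y)%N then rho ^+ 2 else 1).

Lemma weight_ge0 U y t : 0 <= weight U y t.
Proof.
rewrite /weight mulr_ge0 //; last by case: ifP => //; rewrite exprn_ge0 // ltW.
by case: ifP => _; rewrite !mulr_ge0 ?gain_ge0.
Qed.

(** This makes the potential a supermartingale. At high degree [rho ^+ 2] beats the worst gains
    pointwise; otherwise [sum_gain] bounds the mean. *)
Lemma mean_weight U y : (\sum_t weight U y t) / #|{: 'I_n * 'I_n.-1}|%:R <= 1.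
Proof.
have n1_gt0 : (0 : R) < n%:R - 1 by rewrite subr_gt0 ltr1n.
have n_gt0 : (0 : R) < n%:R by rewrite ltr0n ltnW.
rewrite card_pick ler_pdivrMr ?mulr_gt0 // mul1r.
have [deg_gt|deg_le] := boolP (b < deg_in U y)%N.
  apply: (@le_trans _ _ (\sum_(t : 'I_n * 'I_n.-1) 1)); last first.
    by rewrite sumr_const -card_pick.
  apply: ler_sum => t _; rewrite /weight deg_gt.
  have rho2 : 0 <= rho ^+ 2 by rewrite exprn_ge0 // ltW.
  have rhoV : rho^-1 * rho = 1 by rewrite mulVf // gt_eqF.
  have gain1 : gain 1 U y t.1 <= rho^-1 by rewrite gain_le // ler1n.
  have g2 i : 0 <= gain 2 U y i <= rho^-1 by rewrite gain_le ?gain_ge0.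
  case: ifP => _.
    apply: (@le_trans _ _ (2^-1 * rho^-1 * rho ^+ 2)); first by rewrite ler_wpM2r // ler_wpM2l.
    rewrite expr2 -mulrA [rho^-1 * _]mulrA rhoV; move: rho_le rho_gt0; lra.
  apply: (@le_trans _ _ (9^-1 * (rho^-1 * rho^-1) * rho ^+ 2)).
    rewrite ler_wpM2r // ler_wpM2l //.
    by case/andP: (g2 t.1) => ? ?; case/andP: (g2 (lift t.1 t.2)) => ? ?; exact: ler_pM.
  by rewrite expr2 -mulrA mulrACA rhoV; lra.
rewrite -leqNgt in deg_le.
rewrite /weight ltnNge deg_le /=.
under eq_bigr do rewrite mulr1.
have card1 : n.-1%:R = n%:R - 1 :> R by rewrite -subn1 natrB // ltnW.
case: (par y); rewrite -mulr_sumr.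
  rewrite sum_pick1 card1 [leRHS]mulrC mulrCA ler_wpM2l ?(ltW n1_gt0) //.
  by have := sum_gain ler01 deg_le; lra.
rewrite sum_pick2.
have := sum_gain (ler0n R 2%N) deg_le; have := sum_sqr (gain 2 U y).
have : 0 <= \sum_i gain 2 U y i by rewrite sumr_ge0 // => i _; rewrite gain_ge0.
set s := \sum_i gain 2 U y i; set q := \sum_i _ ^+ 2 => s0 sq s3.
have s9 : s ^+ 2 <= (3 * n%:R) ^+ 2 by rewrite lerXn2r ?nnegrE ?mulr_ge0 //; lra.
rewrite ler_pdivrMl //; rewrite -(ler_pM2l n_gt0) mulrBr.
(* [sum_sqr] gives [n * (s ^ 2 - q) <= (n - 1) * s ^ 2]: two distinct directions do no worse than
   two independent ones. *)
apply: (@le_trans _ _ ((n%:R - 1) * s ^+ 2)); first by rewrite mulrBl mul1r lerB.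
apply: (@le_trans _ _ ((n%:R - 1) * (3 * n%:R) ^+ 2)); first by rewrite ler_wpM2l // ltW.
by rewrite le_eqVlt; apply/orP; left; apply/eqP; ring.
Qed.

Lemma frontier_step P U y (N : {set cube n}) : P \subset U -> y \in U -> y \notin N ->
  (U :|: N) :\: (y |: P) = ((U :\: P) :\ y) :|: (N :\: U).
Proof.
move=> sPU yU yN; apply/setP => v; rewrite !inE.
have [->|vy] := eqVneq v y; first by rewrite yU (negbTE yN).
case vP: (v \in P) => /=; first by rewrite (fintype.subsetP sPU _ vP) /=.
by case: (v \in U); rewrite //= orbF.
Qed.

Lemma picks_notin t y : y \notin picks t y.
Proof. by rewrite /picks; case: ifP => _; rewrite !inE ?negb_or ![y == _]eq_sym !flipN. Qed.

Lemma card_bad_step P U y N : P \subset U -> y \notin P ->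
  (#|bad P U| + (b < deg_in U y) <= #|bad (y |: P) (U :|: N)|)%N.
Proof.
move=> sPU yP; have sUN : U \subset U :|: N by exact: finset.subsetUl.
have sbad : bad P U \subset bad (y |: P) (U :|: N).
  apply/fintype.subsetP => v; rewrite !inE => /andP[-> bv]; rewrite orbT /=.
  exact: leq_trans bv (deg_inS _ sUN).
case: (boolP (b < deg_in U y)%N) => by_; last by rewrite addn0 subset_leq_card.
suff <- : #|y |: bad P U| = (#|bad P U| + 1)%N.
  rewrite subset_leq_card // finset.subUset sbad andbT finset.sub1set !inE eqxx /=.
  exact: leq_trans by_ (deg_inS _ sUN).
by rewrite cardsU1 addnC !inE (negbTE yP).
Qed.

(** By [few], the difference [r - #|bad _ _|] is not truncated, so it drops by at least one when a
    vertex of high degree is processed. *)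
Lemma bad_factor P U y N : P \subset U -> y \notin P -> (#|U :|: N| <= 3 * e)%N ->
  rho^-1 ^+ (2 * (r - #|bad (y |: P) (U :|: N)|)) <=
  (if (b < deg_in U y)%N then rho ^+ 2 else 1) * rho^-1 ^+ (2 * (r - #|bad P U|)).
Proof.
move=> sPU yP leU; have := @card_bad_step P U y N sPU yP.
have : (#|bad (y |: P) (U :|: N)| <= r)%N.
  apply: leq_trans (few leU); rewrite subset_leq_card //.
  by apply/fintype.subsetP => v; rewrite !inE => /andP[].
have rhoV1 : 1 <= rho^-1 by rewrite (le_trans _ rhoV_ge2) // ler1n.
case: ifP => _ le_r le_bad; last first.
  by rewrite mul1r ler_weXn2l //; move: le_r le_bad; lia.
rewrite -ler_pdivrMl ?exprn_gt0 // -exprVn -exprD ler_weXn2l //.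
by move: le_r le_bad; lia.
Qed.

(** The parameter [X] serves twice: as the identity and as [odds]. *)
Lemma card_frontier P U y (N : {set cube n}) (X : {set cube n} -> {set cube n}) :
    (forall A A', X (A :|: A') = X A :|: X A') -> (forall A, X A \subset A) ->
    P \subset U -> y \in U -> y \notin N ->
  #|X ((U :|: N) :\: (y |: P))| = (#|X ((U :\: P) :\ y)| + #|X (N :\: U)|)%N.
Proof.
move=> XU subX sPU yU yN; rewrite frontier_step // XU cardsU.
rewrite (_ : X _ :&: X _ = finset.set0) ?cards0 ?subn0 //.
apply/setP => v; rewrite !inE; apply/andP => -[].
move=> /(fintype.subsetP (subX _)) + /(fintype.subsetP (subX _)).
by rewrite !inE => /and3P[_ _ ->].
Qed.

Lemma oddsU A A' : odds (A :|: A') = odds A :|: odds A'.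
Proof. by apply/setP => v; rewrite !inE andb_orl. Qed.

Lemma odds_sub A : odds A \subset A.
Proof. by apply/fintype.subsetP => v; rewrite inE => /andP[]. Qed.

Lemma card_odds_rem A y : y \in A -> #|odds A| = (par y + #|odds (A :\ y)|)%N.
Proof.
move=> yA; rewrite (cardsD1 y) inE yA /=; congr (_ + _)%N.
by congr #|pred_of_set _|; apply/setP => v; rewrite !inE andbA.
Qed.

Lemma card_evensU1 P y : y \notin P -> #|evens (y |: P)| = (~~ par y + #|evens P|)%N.
Proof.
move=> yP; rewrite (cardsD1 y) !inE eqxx /=; congr (_ + _)%N.
congr #|pred_of_set _|; apply/setP => v; rewrite !inE.
by have [->|] := eqVneq v y; rewrite //= (negbTE yP).
Qed.

(** Processing [y] removes it from the frontier; an even [y] also lowers [e - #|evens P|]. So the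
    exponent of [rho] drops by the number of picks at [y], and each discovery restores one. *)
Lemma potential_step P U y t : P \subset U -> y \in U -> y \notin P ->
    (#|evens (U :|: picks t y)| <= e)%N -> (#|U :|: picks t y| <= 3 * e)%N ->
  potential (y |: P) (U :|: picks t y) <= weight U y t * potential P U.
Proof.
move=> sPU yU yP le_ev le_U; have yN := picks_notin t y.
have := bad_factor sPU yP le_U; rewrite /potential /weight.
set kap := (if _ then _ else _); set D := rho^-1 ^+ _; set D' := rho^-1 ^+ _ => leD.
have card_q : #|U :\: P| = (#|(U :\: P) :\ y|).+1.
  by rewrite (cardsD1 y) !inE yU yP.
rewrite (card_frontier (X := id)) // (card_frontier (X := odds) oddsU odds_sub) //.
rewrite card_q (@card_odds_rem (U :\: P) y) ?inE ?yU ?yP // card_evensU1 //.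
have ge_ev : (~~ par y + #|evens P| <= e)%N.
  rewrite -card_evensU1 // (leq_trans _ le_ev) // evensS // finset.subUset.
  rewrite finset.sub1set inE yU /= (fintype.subset_trans sPU) //.
  exact: finset.subsetUl.
set q := #|(U :\: P) :\ y|; set qo := #|odds ((U :\: P) :\ y)|.
have rho_neq0 : rho != 0 by rewrite gt_eqF.
suff -> : rho ^+ (q + #|picks t y :\: U| + (e - (~~ par y + #|evens P|))) *
    2 ^+ (qo + #|odds (picks t y :\: U)|) * 9 ^+ (e - (~~ par y + #|evens P|)) =
    (if par y then 2^-1 * gain 1 U y t.1
     else 9^-1 * (gain 2 U y t.1 * gain 2 U y (lift t.1 t.2))) *
    (rho ^+ (q.+1 + (e - #|evens P|)) * 2 ^+ (par y + qo) * 9 ^+ (e - #|evens P|)).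
  set G := (if par y then _ else _); set W := (_ * _ * _).
  rewrite [leRHS](_ : _ = G * W * (kap * D')); last by ring.
  rewrite ler_wpM2l //; apply: mulr_ge0.
    by rewrite /G; case: ifP => _; rewrite !mulr_ge0 ?gain_ge0.
  by rewrite !mulr_ge0 ?exprn_ge0 // ltW.
move: ge_ev; rewrite /picks /gain; case py: (par y) => /= ge_ev.
  have -> : odds ([set flip y t.1] :\: U) = finset.set0.
    apply/setP => v; rewrite !inE; apply/negP => /andP[/andP[_ /eqP->]].
    by rewrite par_flip py.
  rewrite cards0 addn0 add0n add1n.
  have -> : #|[set flip y t.1] :\: U| = (flip y t.1 \notin U) :> nat.
    case: (boolP (flip y t.1 \in U)) => zU.
      apply: eq_card0 => v; rewrite !inE; apply/negP => /andP[+ /eqP ev].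
      by rewrite ev zU.
    rewrite (_ : _ :\: U = [set flip y t.1]) ?cards1 //; apply/setP => v.
    by rewrite !inE; case: eqP => [->|]; rewrite ?zU ?andbF.
  by case: (flip y t.1 \in U) => /=; rewrite ?addn0 ?addn1 !addSn !exprS;
    move: (rho ^+ (q + _)) (2 ^+ qo) (9 ^+ _) => X Y Z; field.
set z1 := flip y t.1; set z2 := flip y (lift t.1 t.2).
have zN : z1 != z2 by rewrite (inj_eq (@flip_inj _ _)) neq_lift.
have -> : odds ([set z1; z2] :\: U) = [set z1; z2] :\: U.
  apply/setP => v; rewrite !inE; case: (v \in U) => //=.
  by case: (boolP (_ || _)) => // /orP[]/eqP->; rewrite par_flip py.
have -> : #|[set z1; z2] :\: U| = ((z1 \notin U) + (z2 \notin U))%N.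
  rewrite (cardsD1 z1) (cardsD1 z2) !inE !eqxx [z2 == z1]eq_sym zN !andbT !orbT !andbT addnA.
  rewrite [X in (_ + X)%N](_ : _ = 0%N) ?addn0 //.
  apply: eq_card0 => v; rewrite !inE; case: (v == z1); case: (v == z2); rewrite ?andbF //.
set k := (e - (1 + #|evens P|))%N.
have -> : (e - #|evens P| = k.+1)%N by rewrite /k add1n subnSK.
rewrite add0n.
by case: (z1 \in U); case: (z2 \in U) => /=;
   rewrite ?addn0 ?addn1 ?addn2 !(addSn, addnS) ?addn0 !exprS;
   move: (rho ^+ (q + k)) (2 ^+ qo) (9 ^+ k) => X Y Z; field.
Qed.

(** Induction on the number of unprocessed vertices, revealing one frontier vertex [y] at a time.
    The event is void once [U] has more than [e] even vertices; otherwise [potential_step] and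
    [mean_weight] carry the bound through. The hypothesis on odd vertices keeps sizes below [3 * e],
    as [few] requires. *)
Lemma pr_reach_eq P U : P \subset U -> (#|odds U| <= 2 * #|evens P|)%N ->
    (#|evens U| <= e)%N ->
  pr R (fun w => #|evens (reach (stage1 w) P U)| == e) <= potential P U.
Proof.
have [m] := ubnP #|~: P|; elim: m => // m IHm in P U *.
move=> /ltnSE-leP sPU oddU evU.
have [sUP|] := boolP (U \subset P).
  have {sUP} eUP : U = P by apply/eqP; rewrite finset.eqEsubset sUP.
  (* With an empty frontier, either the event is void or the potential is at least 1. *)
  subst U; have [e_eq|/eqP eN] := eqVneq #|evens P| e; last first.
    by rewrite pr_pred0 ?potential_ge0 // => w; rewrite reach_id; apply/eqP.
  rewrite (le_trans (pr_le1 _ _)) // /potential e_eq subnn finset.setDv cards0 !expr0 mul1r mulr1.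
  rewrite (_ : odds _ = finset.set0); last by apply/setP => v; rewrite !inE.
  by rewrite cards0 expr0 mul1r exprn_ege1 // (le_trans _ rhoV_ge2) // ler1n.
case/fintype.subsetPn => y yU yP.
pose F (t : 'I_n * 'I_n.-1) (w : {ffun cube n -> 'I_n * 'I_n.-1}) :=
  #|evens (reach (stage1 w) (y |: P) (U :|: picks t y))| == e.
apply: (le_trans (pr_reveal R (y := y) (F := F) _ _)).
- by move=> w; rewrite /F -/(stage1 w y) -reach_step.
- move=> t w w' ww'; rewrite /F (@eq_reach _ (stage1 w) (stage1 w')) // => v.
  by rewrite !inE negb_or => /andP[vy _]; rewrite /stage1 ww' // inE.
have leF t : pr R (F t) <= weight U y t * potential P U.
  have [evN|evN] := leqP #|evens (U :|: picks t y)| e; last first.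
    rewrite pr_pred0 ?(mulr_ge0 (weight_ge0 _ _ _) (potential_ge0 _ _)) // => w.
    rewrite /F gtn_eqF // (leq_trans evN) // evensS //; exact: sub_reach.
  have oddN : (#|odds (U :|: picks t y)| <= 2 * #|evens (y |: P)|)%N.
    rewrite oddsU card_evensU1 // (leq_trans (leq_card_setU _ _)) //.
    suff : (#|odds (picks t y)| <= 2 * ~~ par y)%N by move: oddU; lia.
    rewrite /picks; case py: (par y) => /=.
      rewrite muln0 leqn0; apply/eqP/eq_card0 => v; rewrite !inE.
      by apply/negP => /andP[/eqP->]; rewrite par_flip py.
    by rewrite (leq_trans (subset_leq_card (odds_sub _))) // cards2; case: (_ != _).
  have evP : (#|evens (y |: P)| <= e)%N.
    rewrite (leq_trans _ evN) // evensS // finset.subUset finset.sub1set inE yU /=.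
    by rewrite (fintype.subset_trans sPU) // finset.subsetUl.
  apply: le_trans (potential_step sPU yU yP evN _); last first.
    by rewrite card_evens_odds; move: oddN evN evP; lia.
  apply: IHm => //.
    apply: leq_trans leP; rewrite (cardsD1 y (~: P)) inE yP ltnS subset_leq_card //.
    by apply/fintype.subsetP => v; rewrite !inE negb_or.
  rewrite finset.subUset finset.sub1set inE yU /=.
  by rewrite (fintype.subset_trans sPU) // finset.subsetUl.
apply: (@le_trans _ _ ((\sum_t weight U y t * potential P U) / #|{: 'I_n * 'I_n.-1}|%:R)).
  by rewrite ler_wpM2r // ler_sum.
rewrite -mulr_suml mulrAC -[leRHS]mul1r ler_wpM2r ?potential_ge0 //.
exact: mean_weight.
Qed.

(** This is the potential at [P] empty and [U = [set x]]. Even [e = 1] leaves [rho ^+ 2], the source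
    of the later bound in [1 / n ^ 2]. *)
Lemma pr_reach1_eq x : ~~ par x -> (0 < e)%N ->
  pr R (fun w => #|evens (reach (stage1 w) finset.set0 [set x])| == e) <=
  rho ^+ e.+1 * 9 ^+ e * rho^-1 ^+ (2 * r).
Proof.
move=> px e_gt0.
have ev0 : evens finset.set0 = finset.set0 by apply/setP => v; rewrite !inE.
have od1 : odds [set x] = finset.set0.
  by apply/setP => v; rewrite !inE; case: eqP => //= ->; rewrite (negbTE px).
apply: le_trans (pr_reach_eq _ _ _) _; rewrite ?finset.sub0set ?od1 ?cards0 //.
  apply: leq_trans e_gt0; rewrite -(cards1 x) subset_leq_card //.
  by apply/fintype.subsetP => v; rewrite !inE => /andP[].
rewrite /potential finset.setD0 od1 ev0 !cards0 cards1 subn0 add1n expr0 mulr1.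
rewrite (_ : bad _ _ = finset.set0) ?cards0 ?subn0 //.
by apply/setP => v; rewrite !inE.
Qed.

End Bound.
End Exploration.

(** * Probability that an even vertex reaches few even vertices *)

Section SmallReach.
Variable R : realType.

(** The bound by 6 is the point; the exact partial sum makes the induction work. *)
Lemma sum_sqr_half (M : nat) :
  \sum_(e < M) (e%:R ^+ 2 / 2 ^+ e : R) = 6 - 2 * (M%:R ^+ 2 + 2 * M%:R + 3) / 2 ^+ M.
Proof.
elim: M => [|M IHM]; first by rewrite big_ord0 expr0; field.
rewrite big_ord_recr /= IHM [2 ^+ M.+1]exprS -[M.+1%:R]natr1.
by field; rewrite expf_neq0 // pnatr_eq0.
Qed.

(** The power of 18 is [rho^-1 ^+ (2 * r)] at [rho = 1 / 18] and [r = 108 * K]; [54 ^+ 2] allows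
    inserting [(54 * e / n) ^+ 2 >= 1] when [54 * e > n]. *)
Definition reach_const (K : nat) : R := 54 ^+ 2 * 18 ^+ (2 * (108 * K)).

(** Two regimes. For [54 * e <= n], take [rho = 3 * e / n] and no exceptional vertices, since no
    degree exceeds [#|U| <= 3 * e]. For larger [e], take [rho = 1 / 18] and allow [108 * K]
    exceptional vertices. *)
Lemma pr_reach1_term n (K e : nat) (x : cube n) :
    (100 * (80 * K) <= n)%N -> (1 < n)%N -> (0 < e < K * n)%N -> ~~ par x ->
  pr R (fun w => #|evens (reach (stage1 w) finset.set0 [set x])| == e) <=
  reach_const K / n%:R ^+ 2 * (e%:R ^+ 2 / 2 ^+ e).
Proof.
move=> n_ge n_gt1 /andP[e_gt0 e_lt] px.
have n0 : (0 : R) < n%:R by rewrite ltr0n ltnW.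
have e0 : (0 : R) < e%:R by rewrite ltr0n.
have p2 : (0 : R) < 2 ^+ e by rewrite exprn_gt0.
have K1 : (1 : R) <= 18 ^+ (2 * (108 * K)) by rewrite exprn_ege1 // ler1n.
have [e_small|e_large] := leqP (54 * e) n.
  have e_small' : 54 * e%:R <= n%:R :> R by rewrite -natrM ler_nat.
  have rho0 : (0 : R) < 3 * e%:R / n%:R by rewrite divr_gt0 ?mulr_gt0.
  apply: (le_trans (pr_reach1_eq (b := 3 * e) (r := 0) n_gt1 rho0 _ _ _ px e_gt0)).
  - by rewrite ler_pdivrMr //; move: e_small' e0; lra.
  - by rewrite divfK ?gt_eqF // natrM.
  - move=> U leU; rewrite leqn0; apply/eqP/eq_card0 => y; rewrite !inE ltnNge.
    by rewrite (leq_trans (deg_in_le_card _ _) leU).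
  rewrite muln0 expr0 mulr1.
  have -> : (3 * e%:R / n%:R) ^+ e.+1 * 9 ^+ e =
      9^-1 * (27 * e%:R / n%:R) ^+ e.+1 :> R.
    rewrite (_ : 27 * e%:R / n%:R = 9 * (3 * e%:R / n%:R)); last by field; rewrite gt_eqF.
    rewrite [(9 * _) ^+ _]exprMn [9 ^+ e.+1]exprS.
    by move: (_ ^+ e.+1) (9 ^+ e) => X Y; field.
  rewrite -(prednK e_gt0) exprS exprS prednK //.
  (* Since [z <= 1 / 2], two factors [z] yield [e ^ 2 / n ^ 2] and the other [e.-1] yield the decay
     [2 / 2 ^+ e]. *)
  set z := 27 * _ / _.
  have z0 : 0 <= z by rewrite divr_ge0 ?mulr_ge0 // ltW.
  have z_le : z ^+ e.-1 <= 2 / 2 ^+ e.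
    rewrite (_ : 2 / 2 ^+ e = 2^-1 ^+ e.-1 :> R); last first.
      by rewrite -(prednK e_gt0) exprS /= exprVn; field; rewrite expf_neq0 ?pnatr_eq0.
    rewrite lerXn2r ?nnegrE ?invr_ge0 //.
    by rewrite ler_pdivrMr //; move: e_small'; lra.
  apply: (@le_trans _ _ (9^-1 * (z * (z * (2 / 2 ^+ e))))).
    by rewrite ler_wpM2l // ler_wpM2l // ler_wpM2l.
  rewrite (_ : 9^-1 * _ = (2 * 81) / n%:R ^+ 2 * (e%:R ^+ 2 / 2 ^+ e)); last first.
    by rewrite /z; field; rewrite !gt_eqF.
  rewrite ler_wpM2r ?divr_ge0 ?sqr_ge0 ?(ltW p2) //.
  rewrite ler_wpM2r ?invr_ge0 ?sqr_ge0 // /reach_const.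
  by apply: (@le_trans _ _ (54 ^+ 2)); [lra|rewrite ler_peMr].
apply: (le_trans (pr_reach1_eq (rho := 18^-1) (b := n %/ 18) (r := 108 * K)
  n_gt1 _ _ _ _ px e_gt0)).
- by rewrite invr_gt0.
- by lra.
- by rewrite mulrC ler_pdivlMr // -natrM ler_nat leq_trunc_div.
(* Degrees above [n %/ 18] are at least [m > n / 18], so [108 * K] of them sum to more than
   [6 * K * n]. Here [#|U| < 3 * K * n], and [2 * r.+1 ^ 2 < 3 * K * n] because [n >= 8000 * K]. *)
- move=> U leU; apply: (few_bad leU).
  have : (n < 18 * (n %/ 18).+1)%N by rewrite mulnC -ltn_divLR.
  have K_gt0 : (0 < K)%N by case: (K) e_lt => //; rewrite mul0n.
  have KK : (K <= K * K)%N by rewrite leq_pmulr.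
  set m := (n %/ 18).+1 => n_lt.
  have Km : (K * n <= 18 * (K * m))%N by rewrite mulnCA leq_mul2l (ltnW n_lt) orbT.
  have Kn : (100 * (80 * (K * K)) <= K * n)%N by rewrite !(mulnCA _ K) leq_mul2l n_ge orbT.
  have -> : ((108 * K).+1 ^ 2 = 108 * 108 * (K * K) + 216 * K + 1)%N.
    by rewrite -addn1 sqrnD expnMn -!mulnn; lia.
  have -> : ((108 * K).+1 * m = 108 * (K * m) + m)%N by rewrite -addn1 mulnDl mul1n mulnA.
  move: (K * K)%N (K * m)%N (K * n)%N e_lt KK Km Kn K_gt0 => A B C; clear; lia.
rewrite invrK.
apply: (@le_trans _ _ (18 ^+ (2 * (108 * K)) / 2 ^+ e)).
  rewrite mulrC ler_wpM2l ?exprn_ge0 // exprS exprVn.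
  rewrite (_ : 18 ^+ e = 9 ^+ e * 2 ^+ e :> R); last by rewrite -exprMn -natrM.
  rewrite (_ : _ * _ = 18^-1 / 2 ^+ e); last first.
    by field; rewrite !expf_neq0 ?pnatr_eq0.
  by rewrite ler_piMl ?invr_ge0 ?ltW // invf_lt1 // ltr1n.
rewrite /reach_const.
rewrite [leRHS](_ : _ = 18 ^+ (2 * (108 * K)) / 2 ^+ e *
  (54 * e%:R / n%:R) ^+ 2); last first.
  by field; rewrite !gt_eqF.
rewrite ler_peMr // ?divr_ge0 ?exprn_ge0 // exprn_ege1 // ler_pdivlMr // mul1r.
by rewrite -natrM ler_nat ltnW.
Qed.

Lemma pr_reach1_small n (K : nat) (x : cube n) :
    (100 * (80 * K) <= n)%N -> (1 < n)%N -> ~~ par x ->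
  pr R (fun w => #|evens (reach (stage1 w) finset.set0 [set x])| < K * n)%N <=
  6 * reach_const K / n%:R ^+ 2.
Proof.
move=> n_ge n_gt1 px; rewrite pr_sum_ord.
have C0 : 0 <= reach_const K / n%:R ^+ 2.
  by rewrite divr_ge0 ?sqr_ge0 // mulr_ge0 ?exprn_ge0.
apply: (@le_trans _ _ (\sum_(e < K * n) reach_const K / n%:R ^+ 2 * (e%:R ^+ 2 / 2 ^+ e))).
  apply: ler_sum => e _; have [e0|e_gt0] := posnP e; last first.
    by apply: pr_reach1_term => //; rewrite e_gt0 /=.
  (* The value [e = 0] is impossible: [x] itself is even and reached. *)
  rewrite pr_pred0 ?mulr_ge0 ?sqr_ge0 ?invr_ge0 ?exprn_ge0 // => w.
  rewrite e0 -lt0n card_gt0; apply/set0Pn; exists x.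
  by rewrite inE px andbT (fintype.subsetP (sub_reach _ _ _)) // inE.
rewrite -mulr_sumr sum_sqr_half -[6 * _ / _]mulrA [leRHS]mulrC.
rewrite ler_wpM2l // gerBl divr_ge0 ?exprn_ge0 // mulr_ge0 // !addr_ge0 ?sqr_ge0 ?mulr_ge0 //.
Qed.

End SmallReach.

(** * Edge cuts and the second stage *)

Section Unions.
Variable R : realType.

Lemma pr_exists (O I : finType) (X : {set I}) (E : I -> pred O) :
  pr R (fun w => [exists A in X, E A w]) <= \sum_(A in X) pr R (E A).
Proof.
rewrite /pr -mulr_suml ler_wpM2r // -natr_sum ler_nat.
apply: (@leq_trans #|\bigcup_(A in X) [set w | E A w]|%SET).
  rewrite subset_leq_card //; apply/fintype.subsetP => w; rewrite inE.
  by case/exists_inP => A AX EA; apply/bigcupP; exists A; rewrite ?inE.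
elim/big_rec2: _ => [|A m S _ IH]; first by rewrite cards0.
by rewrite (leq_trans (leq_card_setU _ _)) // leq_add2l.
Qed.

Lemma pr_pair (O O' : finType) (G : pred O) (E : O -> pred O') (eps : R) :
    0 <= eps -> (forall w, ~~ G w -> pr R (E w) <= eps) ->
  pr R (fun p : O * O' => E p.1 p.2) <= pr R G + eps.
Proof.
move=> eps0 leE.
have -> : pr R (fun p : O * O' => E p.1 p.2) = (\sum_w pr R (E w)) / #|O|%:R.
  rewrite /pr -mulr_suml -mulrA -natr_sum card_prod natrM invfM [_^-1 * _]mulrC.
  congr (_%:R * _).
  have cE w : #|[set w' | E w w']| = (\sum_w' E w w')%N.
    by rewrite -sum1_card big_mkcond /=; apply: eq_bigr => w' _; rewrite inE; case: (E w w').
  rewrite (eq_bigr _ (fun t _ => cE t)) pair_bigA -sum1_card [LHS]big_mkcond /=.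
  by apply: eq_bigr => p _; rewrite inE; case: (E p.1 p.2).
have [card0|card_gt0] := posnP #|O|.
  by rewrite card0 invr0 mulr0 addr_ge0 ?pr_ge0.
have Opos : (0 : R) < #|O|%:R by rewrite ltr0n.
rewrite ler_pdivrMr // mulrDl /pr divfK ?gt_eqF // -sum1_card natr_sum.
have -> : eps * #|O|%:R = \sum_(w : O) eps by rewrite sumr_const mulr_natr.
rewrite [X in _ <= X + _]big_mkcond -big_split /=; apply: ler_sum => w _.
rewrite inE; case: (boolP (G w)) => Gw; last by rewrite add0r leE.
by rewrite (le_trans (pr_le1 _ _)) // lerDl.
Qed.

Lemma pr_family (V T : finType) (S : V -> {set T}) :
  pr R (fun w : {ffun V -> T} => [forall v, w v \in S v]) =
  \prod_v (#|S v|%:R / #|T|%:R).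
Proof.
rewrite /pr big_split /= -natr_prod prodr_const card_ffun natrX exprVn.
congr (_%:R / _); transitivity #|family S|.
  by apply: eq_card => w; rewrite !inE; apply/forallP/familyP.
by rewrite card_family foldrE big_map big_enum.
Qed.

End Unions.

Section EdgeCut.
Variable n : nat.
Implicit Types (a b u v : cube n) (A : {set cube n}).

Definition hybrid a b (m : nat) : cube n := [ffun k : 'I_n => if (k < m)%N then b k else a k].

Lemma hybridS a b (i : 'I_n) :
  hybrid a b i.+1 = if a i == b i then hybrid a b i else flip (hybrid a b i) i.
Proof.
case: eqP => [eab|/eqP nab]; apply/ffunP => k; rewrite !ffunE ltnS leq_eqVlt.
  by case: eqP => // /val_inj->; rewrite ltnn eab.
rewrite -val_eqE; case: eqP => [/val_inj->|_] /=; last by rewrite addbF.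
by rewrite ltnn; move: nab; case: (a i); case: (b i).
Qed.

(* Changing a into b one coordinate at a time crosses the cut at some
   coordinate i; the two hybrids of a and b at that point recover a and b. *)
Lemma edge_cut A :
  (#|A| * #|~: A| <= 2 ^ n * \sum_i #|[set u in A | flip u i \notin A]|)%N.
Proof.
pose X i := [set p : cube n * cube n |
  (hybrid p.1 p.2 (nat_of_ord i) \in A) && (flip (hybrid p.1 p.2 i) i \notin A)].
have -> : (2 ^ n = #|cube n|)%N by rewrite card_ffun card_bool card_ord.
rewrite -cardsX big_distrr /=.
apply: (@leq_trans (\sum_(i < n) #|X i|)%N); last first.
  apply: leq_sum => i _; rewrite mulnC -cardsT -cardsX.
  pose g (p : cube n * cube n) := (hybrid p.1 p.2 i, hybrid p.2 p.1 i).
  have g_inj : injective g.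
    case=> a b [a' b'] [/ffunP e1 /ffunP e2]; congr (_, _); apply/ffunP => k.
      by move: (e1 k) (e2 k); rewrite !ffunE; case: ifP.
    by move: (e1 k) (e2 k); rewrite !ffunE; case: ifP.
  rewrite -(card_imset _ g_inj) subset_leq_card //.
  by apply/fintype.subsetP => q /imsetP[p]; rewrite !inE andbT => ? ->.
have le_bigcup (I : finType) (T : finType) (Y : I -> {set T}) :
    (#|\bigcup_i Y i|%SET <= \sum_i #|Y i|)%N.
  elim/big_rec2: _ => [|i m S _ IH]; first by rewrite cards0.
  by rewrite (leq_trans (leq_card_setU _ _)) // leq_add2l.
apply: leq_trans (le_bigcup _ _ X); rewrite subset_leq_card //.
apply/fintype.subsetP => -[a b]; rewrite !inE => /andP[/= aA bA].
have ex_out : exists m, hybrid a b m \notin A.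
  by exists n; rewrite (_ : hybrid a b n = b) //; apply/ffunP => k; rewrite ffunE ltn_ord.
case: (ex_minnP ex_out) => -[|m] out_m min_m.
  by case/negP: out_m; rewrite (_ : hybrid a b 0 = a) //; apply/ffunP => k; rewrite ffunE.
have m_lt : (m < n)%N.
  rewrite ltnNge; apply/negP => n_le.
  suff /min_m : hybrid a b m \notin A by rewrite ltnn.
  move: out_m; congr (_ \notin A); apply/ffunP => k.
  by rewrite !ffunE (leq_trans (ltn_ord k) n_le) (leq_trans (ltn_ord k)) // ltnW.
have in_m : hybrid a b m \in A.
  by apply/negPn/negP => /min_m; rewrite ltnn.
apply/bigcupP; exists (Ordinal m_lt) => //; rewrite inE /= in_m /=.
move: out_m; rewrite (hybridS a b (Ordinal m_lt)) /=; case: eqP => // _.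
by rewrite in_m.
Qed.

Definition crossing A v := [set i | (flip v i \in A) != (v \in A)].

(** A boundary edge in direction [i], indexed by its end in [A], is reassigned to its odd end; this
    is injective because its two ends are not both in [A]. *)
Lemma odd_crossing A :
  (\sum_i #|[set u in A | flip u i \notin A]| <= \sum_(v | par v) #|crossing A v|)%N.
Proof.
have -> : (\sum_(v | par v) #|crossing A v| =
    \sum_(i < n) #|[set v | par v && ((flip v i \in A) != (v \in A))]|)%N.
  under eq_bigr do rewrite -sum1_card big_mkcond.
  rewrite exchange_big; apply: eq_bigr => i _; rewrite -sum1_card big_mkcond.
  rewrite [RHS]big_mkcond; apply: eq_bigr => v _ /=; rewrite !inE.
  by case: (par v).
apply: leq_sum => i _; pose g u := if par u then u else flip u i.
have g_inj : {in [set u in A | flip u i \notin A] &, injective g}.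
  move=> u u'; rewrite !inE /g => /andP[uA uF] /andP[uA' uF'].
  case pu: (par u); case pu': (par u') => // e.
  - by case/negP: uF'; rewrite -e.
  - by case/negP: uF; rewrite e.
  - exact: (can_inj (flipK i)).
rewrite -(card_in_imset g_inj) subset_leq_card //.
apply/fintype.subsetP => z /imsetP[u]; rewrite !inE => /andP[uA uF] ->.
rewrite /g; case pu: (par u); first by rewrite pu uA (negbTE uF).
by rewrite par_flip pu (flipK i) uA (negbTE uF).
Qed.

End EdgeCut.

(** * Counting unions of components *)

Section Clusters.
Variable V : finType.
Implicit Types (N : V -> {set V}) (A S : {set V}).

(* [A] is a union of connected components of the graph with edges [v -- z],
   for [z \in N v]. *)
Definition saturated N A := [forall v, forall z in N v, (z \in A) == (v \in A)].

Lemma saturatedP N A :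
  reflect (forall v z, z \in N v -> (z \in A) = (v \in A)) (saturated N A).
Proof.
apply: (iffP forallP) => [sA v z zv|sA v]; last first.
  by apply/forall_inP => z zv; apply/eqP; exact: sA.
by apply/eqP; move/forall_inP: (sA v); apply.
Qed.

(** A saturated set is determined by the component roots it contains, and a component avoiding [S]
    has at least [M] vertices. So there are at most [#|S| + #|V| / M <= q] roots. *)
Lemma card_saturated N S (M q : nat) : (0 < M)%N ->
    (forall A x, saturated N A -> x \in A -> [disjoint A & S] -> (M <= #|A|)%N) ->
    (M * #|S| + #|V| <= M * q)%N ->
  (#|[set A | saturated N A]| <= 2 ^ q)%N.
Proof.
move=> M_gt0 large le_q; pose e := [rel u v | (v \in N u) || (u \in N v)].
have e_sym : connect_sym e by apply: sym_connect_sym => u v /=; rewrite orbC.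
pose C r := [set v | fingraph.root e v == r].
have satC r : saturated N (C r).
  apply/saturatedP => v z zv; rewrite !inE; congr (_ == r); apply/eqP.
  by rewrite root_connect // connect1 //= zv orbT.
have sat_root A : saturated N A -> forall v, (fingraph.root e v \in A) = (v \in A).
  move=> /saturatedP sA v; suff : fingraph.closed e A.
    by move/closed_connect; apply; rewrite // e_sym connect_root.
  by move=> u z /= /orP[] /sA.
pose Rt := [set r in codom (fingraph.root e)].
have root_id r : r \in Rt -> fingraph.root e r = r.
  by rewrite inE => /codomP[x ->]; rewrite root_root.
have leR : (M * #|Rt| <= M * #|S| + #|V|)%N.
  rewrite -(cardsID (fingraph.root e @: S)) mulnDr leq_add //.
    rewrite leq_mul2l (leq_trans (subset_leq_card (finset.subsetIr _ _))) ?orbT //.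
    exact: leq_imset_card.
  have -> : #|V| = (\sum_r #|C r|)%N.
    rewrite -sum1_card (partition_big (fingraph.root e) xpredT) //=; apply: eq_bigr => r _.
    by rewrite -sum1_card; apply: eq_bigl => v; rewrite inE.
  rewrite mulnC -sum_nat_const big_mkcond /=; apply: leq_sum => r _.
  case: ifP => //; rewrite inE => /andP[rS rR].
  apply: (large _ r) => //; first by rewrite inE root_id.
  rewrite -setI_eq0; apply/eqP/setP => v; rewrite !inE; apply/negP => /andP[/eqP vr vS].
  by case/negP: rS; apply/imsetP; exists v.
rewrite (leq_trans _ (@leq_pexp2l 2 #|Rt| q _ _)) //; last first.
  by rewrite -(leq_pmul2l M_gt0) (leq_trans leR).
rewrite -card_powerset -(card_in_imset (f := fun A => A :&: Rt)) => [|A B].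
  rewrite subset_leq_card //; apply/fintype.subsetP => B /imsetP[A _ ->].
  by rewrite inE finset.subsetIr.
rewrite !inE => /sat_root sA /sat_root sB /setP eAB; apply/setP => v.
have := eAB (fingraph.root e v); rewrite !inE codom_f !andbT sA sB.
exact.
Qed.

End Clusters.

(** * Adding the second choices of the odd vertices *)

Section Sprinkling.
Variables (R : realType) (n : nat).
Hypothesis n_gt1 : (1 < n)%N.
Implicit Types (A : {set cube n}) (w : {ffun cube n -> 'I_n * 'I_n.-1})
  (xi : {ffun cube n -> 'I_n.-1}).

(* The second choice of a vertex is sampled in stage 1 at even vertices and in
   stage 2 at odd ones. *)
Definition both w xi v : {set cube n} :=
  [set flip v (w v).1; flip v (lift (w v).1 (if par v then xi v else (w v).2))].

Lemma stage1_sub w xi v : stage1 w v \subset both w xi v.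
Proof.
rewrite /stage1 /picks /both; case: ifP => // _.
by apply/fintype.subsetP => z; rewrite !inE => ->.
Qed.

Lemma both_saturated w xi A : saturated (both w xi) A -> saturated (stage1 w) A.
Proof.
move/saturatedP => sA; apply/saturatedP => v z zv; apply: sA.
exact: fintype.subsetP (stage1_sub w xi v) _ zv.
Qed.

(** The first pick stays on the side of [v], so every crossing direction is among the [n.-1]
    candidates for the second pick. *)
Lemma card_crossing_lift w A v : saturated (stage1 w) A ->
  (#|[set j | flip v (lift (w v).1 j) \in A == (v \in A)]| + #|crossing A v| = n.-1)%N.
Proof.
move/saturatedP/(_ v (flip v (w v).1)) => f_in.
have {}f_in : (flip v (w v).1 \in A) = (v \in A).
  by apply: f_in; rewrite /stage1 /picks; case: ifP => _; rewrite !inE eqxx.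
have -> : crossing A v = lift (w v).1 @: [set j | flip v (lift (w v).1 j) \in A != (v \in A)].
  apply/setP => i; rewrite inE; apply/idP/imsetP => [cr|[j + ->]]; last by rewrite inE.
  have [ei|ne] := eqVneq (w v).1 i; first by rewrite -ei f_in eqxx in cr.
  by have [j ej _] := unlift_some ne; exists j; rewrite ?inE -?ej.
rewrite card_imset; last exact: lift_inj.
rewrite -[RHS]card_ord -(cardsC [set j | flip v (lift (w v).1 j) \in A == (v \in A)]).
congr (_ + _)%N; by apply: eq_card => j; rewrite !inE.
Qed.

(** An odd [v] with [c] crossing directions respects [A] with probability
    [1 - c / n.-1 <= expR (- (c / n))], independently over [v]; [odd_crossing] and [edge_cut] bound
    the sum of the [c] from below. *)
Lemma pr_saturated w A : saturated (stage1 w) A ->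
  pr R (fun xi => saturated (both w xi) A) <=
  expR (- ((#|A|%:R * #|~: A|%:R) / (2 ^+ n * n%:R))).
Proof.
move=> sA.
pose S v := if par v then [set j | flip v (lift (w v).1 j) \in A == (v \in A)] else [set: 'I_n.-1].
have n1 : (0 < n.-1)%N by move: n_gt1; case: (n) => [|[]].
have n1_gt0 : (0 : R) < n.-1%:R by rewrite ltr0n.
apply: (@le_trans _ _ (pr R (fun xi : {ffun cube n -> 'I_n.-1} => [forall v, xi v \in S v]))).
  apply: pr_sub => xi /saturatedP sw; apply/forallP => v; rewrite /S.
  case pv: (par v); rewrite inE //; apply/eqP/sw.
  by rewrite /both pv !inE eqxx orbT.
rewrite pr_family.
have le_v v : #|S v|%:R / #|{: 'I_n.-1}|%:R <=
    expR (- (if par v then #|crossing A v|%:R / n%:R else 0)) :> R.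
  rewrite card_ord /S; case: (par v).
    apply: le_trans (expR_ge1Dx _).
    have := card_crossing_lift v sA; set s := #|_|; set c := #|_| => sc.
    rewrite (_ : s%:R = n.-1%:R - c%:R); last by rewrite -sc natrD addrK.
    rewrite mulrBl divff ?gt_eqF // lerB // ler_wpM2l // lef_pV2 ?posrE ?ltr0n ?(ltnW n_gt1) //.
    by rewrite ler_nat leq_pred.
  by rewrite cardsT card_ord divff ?gt_eqF // oppr0 expR0.
apply: (@le_trans _ _ (\prod_v expR (- (if par v then #|crossing A v|%:R / n%:R else 0)))).
  by apply: ler_prod => v _; rewrite le_v andbT divr_ge0.
rewrite -expR_sum ler_expR sumrN lerN2 -big_mkcond /= -mulr_suml.
rewrite invfM mulrA ler_wpM2r ?invr_ge0 // ler_pdivrMr ?exprn_gt0 //.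
rewrite -natr_sum -natrX -!natrM ler_nat [leqRHS]mulnC.
apply: leq_trans (edge_cut A) _; rewrite leq_mul2l odd_crossing orbT //.
Qed.

End Sprinkling.

(** * Union bound over balanced cuts *)

Section BalancedCut.
Variable R : realType.

Definition balanced (n : nat) (delta : R) (A : {set cube n}) :=
  (delta * 2 ^+ n <= #|A|%:R) && (#|A|%:R <= (1 - delta) * 2 ^+ n).

Lemma card_cube n : #|cube n| = (2 ^ n)%N.
Proof. by rewrite card_ffun card_bool card_ord. Qed.

Lemma balanced_area n (delta : R) (A : {set cube n}) : balanced delta A ->
  delta * (1 - delta) * (2 ^+ n) ^+ 2 <= #|A|%:R * #|~: A|%:R.
Proof.
case/andP; have -> : #|~: A|%:R = 2 ^+ n - #|A|%:R :> R.
  by rewrite -natrX -card_cube -(cardsC A) natrD addrAC subrr add0r.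
set a := #|A|%:R; set N := 2 ^+ n => h1 h2.
rewrite -subr_ge0 (_ : _ - _ = (a - delta * N) * ((1 - delta) * N - a)); last by ring.
by rewrite mulr_ge0 ?subr_ge0.
Qed.

Definition stunted (n M : nat) (w : {ffun cube n -> 'I_n * 'I_n.-1}) :=
  [set x | ~~ par x && (#|evens (reach (stage1 w) finset.set0 [set x])| < M)%N].

(** [A] has an even vertex, because the first pick of an odd vertex is even and stays in [A]. That
    vertex is not stunted, and [A] contains all it reaches. *)
Lemma saturated_large n M (w : {ffun cube n -> 'I_n * 'I_n.-1}) (A : {set cube n}) x :
  saturated (stage1 w) A -> x \in A -> [disjoint A & stunted M w] -> (M <= #|A|)%N.
Proof.
move=> /saturatedP sA xA dAS.
have [y yA py] : exists2 y, y \in A & ~~ par y.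
  case: (boolP (par x)) => px; last by exists x.
  exists (flip x (w x).1); last by rewrite par_flip px.
  by rewrite (sA x) // /stage1 /picks px inE.
have : y \notin stunted M w by rewrite (disjointFr dAS).
rewrite inE py /= -leqNgt => /leq_trans; apply.
apply: (@leq_trans #|evens A|); last first.
  by rewrite subset_leq_card //; apply/fintype.subsetP => v; rewrite inE => /andP[].
apply/evensS/reach_min; first by rewrite finset.sub1set.
by apply/closed_offP => v vA _; apply/fintype.subsetP => z /sA->.
Qed.

Lemma sqr_le_exp2 n : (4 <= n)%N -> (n ^ 2 <= 2 ^ n)%N.
Proof.
elim: n => // n IHn; rewrite leq_eqVlt => /orP[/eqP<- //|].
rewrite ltnS => n_ge; have n2 : (4 * n <= n * n)%N by rewrite leq_mul2r n_ge orbT.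
have := IHn n_ge; rewrite [(2 ^ n.+1)%N]expnS -!mulnn [(n.+1 * _)%N]mulSn [(n * n.+1)%N]mulnS.
by move: (2 ^ n)%N (n * n)%N n2 n_ge => A B; lia.
Qed.

Lemma expR_leX2 (q : nat) (x : R) : q%:R <= x -> 2 ^+ q <= expR x.
Proof.
move=> qx; apply: (@le_trans _ _ (expR q%:R)); last by rewrite ler_expR.
rewrite -[q%:R]mulr1 expRM_natl lerXn2r ?nnegrE ?expR_ge0 //.
by apply: le_trans (expR_ge1Dx 1); lra.
Qed.

Lemma expRN_le (x : R) : 0 < x -> expR (- x) <= x^-1.
Proof.
move=> x0; rewrite expRN lef_pV2 ?posrE ?expR_gt0 //.
by apply: le_trans (expR_ge1Dx x); lra.
Qed.

(** The expected number is at most [2 ^+ n] times a bound in [1 / n ^ 2], and Markov's inequality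
    loses only the factor [K * n]. *)
Lemma pr_stunted n K : (100 * (80 * K) <= n)%N -> (1 < n)%N -> (0 < K)%N ->
  pr R (fun w : {ffun cube n -> 'I_n * 'I_n.-1} => 
     2 ^+ n / (K * n)%:R <= #|stunted (K * n) w|%:R :> R) <=
  6 * reach_const R K * K%:R / n%:R.
Proof.
move=> n_ge n_gt1 K_gt0.
have n0 : (0 : R) < n%:R by rewrite ltr0n ltnW.
have K0 : (0 : R) < K%:R by rewrite ltr0n.
have N0 : (0 : R) < 2 ^+ n by rewrite exprn_gt0.
apply: le_trans (pr_markov (M := 2 ^+ n * (6 * reach_const R K / n%:R ^+ 2)) _ _) _.
- by rewrite natrM divr_gt0 ?mulr_gt0.
- rewrite (sum_card_pr R (fun w x =>
    #|evens (reach (stage1 w) finset.set0 [set x])| < K * n)%N (fun x => ~~ par x)).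
  apply: (@le_trans _ _ (\sum_(x : cube n | ~~ par x) (6 * reach_const R K / n%:R ^+ 2))).
    by apply: ler_sum => x px; exact: pr_reach1_small.
  rewrite sumr_const -[leLHS]mulr_natl ler_wpM2r //.
    by rewrite divr_ge0 ?sqr_ge0 // mulr_ge0 // mulr_ge0 ?exprn_ge0.
  by rewrite -natrX ler_nat -card_cube max_card.
rewrite natrM le_eqVlt; apply/orP; left; apply/eqP.
by move: (reach_const R K) => C; field; rewrite !gt_eqF.
Qed.

(** Off the event of [pr_stunted], at most [2 ^ q] sets are saturated after stage 1, and each
    balanced one survives stage 2 with probability at most [expR (- x)]. *)
Lemma pr_balanced_cut (delta : R) : 0 < delta -> delta < 1 ->
  exists D : R, exists n0 : nat, (1 < n0)%N /\ forall n, (n0 <= n)%N ->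
  pr R (fun p : {ffun cube n -> 'I_n * 'I_n.-1} * {ffun cube n -> 'I_n.-1} =>
    [exists A : {set cube n}, saturated (both p.1 p.2) A && balanced delta A]) <= D / n%:R.
Proof.
move=> d0 d1; set c := delta * (1 - delta).
have c0 : 0 < c by rewrite mulr_gt0 // subr_gt0.
(* [K * c >= 4] makes [2 * 2 ^ n / (K * n)] at most [x / 2], so the number of sets costs only half
   of the exponent. *)
have [K K_gt0 leK] : exists2 K, (0 < K)%N & 4 <= K%:R * c.
  exists (Num.bound (4 / c)).+1 => //.
  rewrite -ler_pdivrMr // -[leRHS]natr1 (le_trans (ltW (archi_boundP _))) ?divr_ge0 ?(ltW c0) //.
  by rewrite lerDl.
have K0 : (0 : R) < K%:R by rewrite ltr0n.
exists (6 * reach_const R K * K%:R + expR 1 * (2 / c)), (4 + 100 * (80 * K))%N; split=> // n n_ge.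
have n_gt1 : (1 < n)%N by apply: leq_trans n_ge.
have n_ge4 : (4 <= n)%N by apply: leq_trans n_ge; rewrite leq_addr.
have n_geK : (100 * (80 * K) <= n)%N by apply: leq_trans n_ge; rewrite leq_addl.
have n0 : (0 : R) < n%:R by rewrite ltr0n ltnW.
have N0 : (0 : R) < 2 ^+ n by rewrite exprn_gt0.
pose G (w : {ffun cube n -> 'I_n * 'I_n.-1}) :=
  2 ^+ n / (K * n)%:R <= #|stunted (K * n) w|%:R :> R.
rewrite mulrDl; apply: le_trans (lerD (pr_stunted n_geK n_gt1 K_gt0) (lexx _)).
apply: (@pr_pair R _ _ G (fun w xi =>
  [exists A : {set cube n}, saturated (both w xi) A && balanced delta A])).
  by rewrite !mulr_ge0 ?expR_ge0 ?invr_ge0 ?(ltW c0) ?(ltW n0).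
move=> w; rewrite /G -ltNge natrM ltr_pdivlMr ?mulr_gt0 // -!natrM -natrX ltr_nat => few_stunted.
(* The successor covers the rounding and later costs the factor [expR 1]. *)
pose q := ((2 * 2 ^ n) %/ (K * n)).+1.
have Kn_gt0 : (0 < K * n)%N by rewrite muln_gt0 K_gt0 ltnW.
have le_q : (K * n * #|stunted (K * n) w| + #|cube n| <= K * n * q)%N.
  rewrite card_cube; apply: (@leq_trans (2 * 2 ^ n)); first by move: few_stunted; lia.
  by rewrite [leqRHS]mulnC ltnW // -ltn_divLR.
have := card_saturated Kn_gt0 (@saturated_large n (K * n) w) le_q.
set X := [set A | _] => leX.
pose Xb := [set A in X | balanced delta A].
apply: (@le_trans _ _ (pr R (fun xi : {ffun cube n -> 'I_n.-1} =>
    [exists A in Xb, saturated (both w xi) A]))).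
  apply: pr_sub => xi /existsP[A /andP[sA bA]]; apply/exists_inP; exists A => //.
  by rewrite !inE bA (both_saturated sA).
apply: le_trans (pr_exists R Xb (fun A xi => saturated (both w xi) A)) _.
set x := c * 2 ^+ n / n%:R.
have x0 : 0 < x by rewrite divr_gt0 ?(mulr_gt0 c0 N0).
apply: (@le_trans _ _ (\sum_(A in Xb) expR (- x))).
  apply: ler_sum => A; rewrite !inE => /andP[sA bA].
  apply: le_trans (pr_saturated R n_gt1 sA) _; rewrite ler_expR lerN2.
  rewrite ler_pdivlMr ?mulr_gt0 // /x.
  apply: le_trans (balanced_area bA); rewrite le_eqVlt; apply/orP; left; apply/eqP.
  by rewrite /c; field; rewrite gt_eqF.
rewrite sumr_const -[leLHS]mulr_natl.
apply: (@le_trans _ _ (expR (1 + x / 2) * expR (- x))).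
  rewrite ler_wpM2r ?expR_ge0 //; apply: (@le_trans _ _ (2 ^+ q)).
    rewrite -natrX ler_nat (leq_trans _ leX) // subset_leq_card //.
    by apply/fintype.subsetP => A; rewrite inE => /andP[].
  apply: expR_leX2; rewrite /q -natr1 addrC lerD2l.
  apply: (@le_trans _ _ ((2 * 2 ^ n)%:R / (K * n)%:R)).
    by rewrite ler_pdivlMr ?ltr0n // -natrM ler_nat leq_trunc_div.
  rewrite !natrM natrX ler_pdivrMr ?mulr_gt0 // /x.
  rewrite (_ : c * 2 ^+ n / n%:R / 2 * _ = K%:R * c / 2 * 2 ^+ n); last by field; rewrite gt_eqF.
  by rewrite ler_wpM2r ?(ltW N0) //; lra.
rewrite -expRD (_ : 1 + x / 2 + - x = 1 + - (x / 2)); last by field.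
rewrite expRD -mulrA ler_wpM2l ?expR_ge0 //.
(* The remaining [expR (- (x / 2))] is at most [2 / x], a multiple of [n / 2 ^ n], and
   [n ^ 2 <= 2 ^ n]. *)
apply: (le_trans (expRN_le _)); first by rewrite divr_gt0.
rewrite /x (_ : (c * 2 ^+ n / n%:R / 2)^-1 = 2 / c * (n%:R / 2 ^+ n)); last first.
  by field; rewrite !gt_eqF.
rewrite ler_wpM2l ?divr_ge0 ?(ltW c0) // ler_pdivrMr // ler_pdivlMl //.
by rewrite -natrM -natrX ler_nat mulnn sqr_le_exp2.
Qed.

End BalancedCut.

(** * Sampling the 2-out model *)

Section Pushforward.
Variables (R : realType) (n : nat).
Hypothesis n_gt1 : (1 < n)%N.
Implicit Types (v : cube n) (i k : 'I_n) (S : {set {set cube n}}).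

Definition edge v i : {set cube n} := [set v; flip v i].

Lemma edge_inj v : injective (edge v).
Proof.
move=> i k /setP/(_ (flip v i)); rewrite !inE eqxx orbT (negbTE (flipN v i)) /=.
by move/esym/eqP/flip_inj.
Qed.

Lemma incident_edgesP v (s : {set cube n}) :
  reflect (exists i, s = edge v i) (s \in incident_edges v).
Proof.
rewrite !inE; apply: (iffP andP) => [[/existsP[x /existsP[y]]]|[i ->]].
  move=> /andP[/cube_adjP[i ->] /eqP->]; rewrite !inE => /orP[]/eqP->; exists i => //.
  by rewrite /edge flipK finset.setUC.
split; last by rewrite !inE eqxx.
by apply/existsP; exists v; apply/existsP; exists (flip v i); rewrite cube_adj_flip /edge eqxx.
Qed.

Definition edge_pair v (t : 'I_n * 'I_n.-1) : {set {set cube n}} :=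
  [set edge v t.1; edge v (lift t.1 t.2)].

Lemma edge_pair_choices v t : edge_pair v t \in choices 2 v.
Proof.
rewrite inE /edge_pair cards2 (inj_eq (@edge_inj v)) neq_lift eqxx andbT.
rewrite finset.subUset !finset.sub1set.
by apply/andP; split; apply/incident_edgesP; [exists t.1|exists (lift t.1 t.2)].
Qed.

(* Each admissible pair of edges is sampled in both orders. *)
Lemma card_edge_pair v S : #|[set t | edge_pair v t == S]| = (2 * (S \in choices 2 v))%N.
Proof.
case: (boolP (S \in choices 2 v)) => [|SN]; last first.
  apply: eq_card0 => t; rewrite !inE; apply/negbTE; apply: contra SN => /eqP<-.
  exact: edge_pair_choices.
rewrite inE => /andP[/fintype.subsetP sS /cards2P[e1 [e2 [e12 eS]]]].
have /incident_edgesP[i e1i] : e1 \in incident_edges v by apply: sS; rewrite eS !inE eqxx.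
have /incident_edgesP[k e2k] : e2 \in incident_edges v by apply: sS; rewrite eS !inE eqxx orbT.
subst e1 e2; have ik : i != k by apply: contraNneq e12 => ->.
have [j ej _] := unlift_some ik.
have ki : k != i by rewrite eq_sym.
have [j' ej' _] := unlift_some ki.
have -> : [set t | edge_pair v t == S] = [set (i, j); (k, j')].
  apply/setP => -[a b]; rewrite !inE eS /edge_pair /= !xpair_eqE.
  apply/eqP/orP => [/setP eq_set|[]/andP[/eqP-> /eqP->]]; last 2 first.
  - by rewrite -ej.
  - by rewrite -ej' finset.setUC.
  have := eq_set (edge v a); have := eq_set (edge v (lift a b)).
  rewrite !inE !eqxx ?orbT /= !(inj_eq (@edge_inj v)).
  move=> /esym/orP eb /esym/orP[]/eqP ea; [left|right]; rewrite ea eqxx /=.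
    case: eb => [|/eqP]; rewrite ea; first by rewrite eq_sym (negbTE (neq_lift _ _)).
    by rewrite ej => /lift_inj->.
  case: eb => [/eqP|]; rewrite ea; last by rewrite eq_sym (negbTE (neq_lift _ _)).
  by rewrite ej' => /lift_inj->.
by rewrite cards2 xpair_eqE (negbTE ik).
Qed.

Lemma card_choices2 v : #|{: 'I_n * 'I_n.-1}| = (2 * #|choices 2 v|)%N.
Proof.
rewrite -[LHS]sum1_card (partition_big (edge_pair v) (fun S => S \in choices 2 v)) /=
  => [|t _]; last exact: edge_pair_choices.
rewrite (eq_bigr (fun=> 2%N)) => [|S SC]; first by rewrite sum_nat_const mulnC.
transitivity (2 * (S \in choices 2 v))%N; last by rewrite SC.
rewrite -card_edge_pair sum1_card.
by apply: eq_card => t; rewrite !inE.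
Qed.

Definition second v (t : 'I_n * 'I_n.-1) (j : 'I_n.-1) : 'I_n * 'I_n.-1 :=
  (t.1, if par v then j else t.2).

Definition kout_of (p : {ffun cube n -> 'I_n * 'I_n.-1} * {ffun cube n -> 'I_n.-1}) : outcome n :=
  [ffun v => edge_pair v (second v (p.1 v) (p.2 v))].

(** At either parity one of [t.2] and [j] is discarded, so every ordered pair of distinct directions
    arises [n.-1] times and every admissible pair of edges twice as often. *)
Lemma uniform_mass_choices v S :
  uniform_mass R (choices 2 v) S =
  \sum_t \sum_j (S == edge_pair v (second v t j))%:R /
     (#|{: 'I_n * 'I_n.-1}|%:R * #|{: 'I_n.-1}|%:R).
Proof.
have n1_neq0 : n.-1%:R != 0 :> R by rewrite pnatr_eq0; move: n_gt1; case: (n) => [|[]].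
have n0 : n%:R != 0 :> R by rewrite pnatr_eq0; move: n_gt1; case: (n).
under eq_bigr do rewrite -mulr_suml.
rewrite -mulr_suml.
have -> : \sum_t \sum_j (S == edge_pair v (second v t j))%:R =
    #|{: 'I_n.-1}|%:R * #|[set t | edge_pair v t == S]|%:R :> R.
  rewrite [X in _ * X](_ : _ = \sum_t (S == edge_pair v t)%:R); last first.
    rewrite -sum1_card natr_sum big_mkcond; apply: eq_bigr => t _; rewrite inE eq_sym.
    by case: eqP.
  rewrite /second; case: (par v).
    rewrite -(pair_bigA _ (fun i (k : 'I_n.-1) => \sum_j (S == edge_pair v (i, j))%:R)) /=.
    rewrite -(pair_bigA _ (fun i j => (S == edge_pair v (i, j))%:R)) mulr_sumr /=.
    by apply: eq_bigr => i _; rewrite sumr_const mulr_natl.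
  rewrite mulr_sumr; apply: eq_bigr => -[i k] _ /=.
  by rewrite sumr_const mulr_natl.
rewrite card_edge_pair /uniform_mass (card_choices2 v) card_ord !natrM.
have C_neq0 : #|choices 2 v|%:R != 0 :> R.
  have : #|{: 'I_n * 'I_n.-1}|%:R != 0 :> R by rewrite card_prod !card_ord natrM mulf_neq0.
  by rewrite (card_choices2 v) natrM mulf_eq0 negb_or => /andP[].
by field; rewrite n1_neq0.
Qed.

(** The product of sums over single-vertex samples expands into one sum over pairs of families of
    equal mass, grouped by [kout_of]. *)
Lemma kout_prob_pr (E : pred (outcome n)) :
  kout_prob R 2 E = pr R (fun p => E (kout_of p)).
Proof.
set c : R := (#|{: 'I_n * 'I_n.-1}|%:R * #|{: 'I_n.-1}|%:R)^-1.
have mass w : kout_mass R 2 w = \sum_p (w == kout_of p)%:R * c ^+ #|cube n|.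
  rewrite /kout_mass (eq_bigr _ (fun v _ => uniform_mass_choices v (w v))).
  rewrite bigA_distr_bigA.
  rewrite -(pair_bigA _ (fun t xi => (w == kout_of (t, xi))%:R * c ^+ #|cube n|)) /=.
  apply: eq_bigr => t _; rewrite bigA_distr_bigA; apply: eq_bigr => xi _.
  rewrite big_split /= prodr_const; congr (_ * _).
  case: eqP => [->|wN].
    by rewrite big1 // => v _; rewrite ffunE eqxx.
  have [v /negbTE wv] : exists v, w v != edge_pair v (second v (t v) (xi v)).
    apply/existsP; rewrite -negb_forall; apply/negP => /forallP wE.
    by apply: wN; apply/ffunP => v; rewrite ffunE; apply/eqP.
  by rewrite (bigD1 v) //= wv mul0r.
rewrite /kout_prob (eq_bigr _ (fun w _ => mass w)) exchange_big /= /pr.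
rewrite -sum1_card natr_sum [X in _ = X / _]big_mkcond mulr_suml; apply: eq_bigr => p _.
rewrite inE -mulr_suml; congr (_ * _); last first.
  by rewrite card_prod !card_ffun natrM !natrX -exprMn exprVn.
case: ifP => Ep; last first.
  by rewrite big1 // => w Ew; case: eqP => // ew; rewrite ew Ep in Ew.
rewrite (bigD1 (kout_of p)) //= eqxx big1 ?addr0 // => w /andP[_ wN].
by rewrite (negbTE wN).
Qed.

Lemma kout_adj_sym (w : outcome n) : symmetric (kout_adj w).
Proof. by move=> x y; rewrite /kout_adj eq_sym finset.setUC. Qed.

Lemma closed_saturated p (A : {set cube n}) :
    (forall x y, kout_adj (kout_of p) x y -> (x \in A) = (y \in A)) ->
  saturated (both p.1 p.2) A.
Proof.
move=> cA; apply/saturatedP => v z zv; apply/esym/cA; rewrite /kout_adj.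
have vz : exists2 i, z = flip v i & edge v i \in kout_of p v.
  move: zv; rewrite !inE ffunE => /orP[]/eqP->; eexists; try reflexivity;
  by rewrite !inE /= eqxx ?orbT.
case: vz => i -> ei; rewrite eq_sym flipN /=.
by apply/bigcupP; exists v.
Qed.

End Pushforward.

(** * From balanced cuts to a giant component *)

Section Giant.
Variables (T : finType) (e : rel T).
Hypothesis e_sym : symmetric e.

Lemma component_closed x y z : e y z ->
  (y \in [set y | connect e x y]) = (z \in [set y | connect e x y]).
Proof.
move=> eyz; rewrite !inE; apply/idP/idP => h; apply: connect_trans h (connect1 _) => //.
by rewrite e_sym.
Qed.

Lemma components_disjoint (C C' : {set T}) : C \in components e -> C' \in components e ->
  C != C' -> [disjoint C & C'].
Proof.
move=> /imsetP[x _ ->] /imsetP[x' _ ->]; apply: contraNT => /pred0Pn[z] /=.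
rewrite !inE => /andP[xz x'z].
have csym := sym_connect_sym e_sym.
have xx' : connect e x x' by rewrite (connect_trans xz) // csym.
by apply/eqP/setP => y; rewrite !inE (same_connect csym xx').
Qed.

(** Take a largest closed [A] of density below [delta] and the component [C] of a vertex outside it.
    If [C] were small, [A :|: C] would have density below [2 * delta <= 1 - delta], hence below
    [delta] as it is not balanced, against the maximality of [A]. *)
Lemma giant_component (R : realType) (delta : R) :
    0 < delta -> delta <= 3^-1 -> (0 < #|T|)%N ->
    (forall A : {set T}, (forall y z, e y z -> (y \in A) = (z \in A)) ->
       ~~ ((delta * #|T|%:R <= #|A|%:R) && (#|A|%:R <= (1 - delta) * #|T|%:R))) ->
  exists2 C, C \in components e & (1 - delta) * #|T|%:R < #|C|%:R.
Proof.
move=> d0 d3 T_gt0 unbal.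
have T0 : (0 : R) < #|T|%:R by rewrite ltr0n.
pose small (A : {set T}) := [forall y, forall z, e y z ==> ((y \in A) == (z \in A))] &&
  (#|A|%:R < delta * #|T|%:R).
have small0 : small finset.set0.
  rewrite /small cards0 mulr_gt0 // andbT.
  by apply/forallP => y; apply/forallP => z; rewrite !inE implybT.
case: (arg_maxnP (fun A : {set T} => #|A|) small0) => A /andP[cA ltA] maxA.
have {}cA y z : e y z -> (y \in A) = (z \in A).
  by move=> eyz; move/forallP/(_ y)/forallP/(_ z): cA; rewrite eyz => /eqP.
have [x xA] : exists x, x \notin A.
  apply/existsP; rewrite -negb_forall; apply/negP => /forallP allA.
  have : #|A| = #|T| by apply: eq_card => y; rewrite allA.
  move=> eAT; move: ltA; rewrite eAT -subr_gt0 -[X in _ - X]mul1r -mulrBl.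
  by rewrite pmulr_lgt0 // subr_gt0; move: d3; lra.
pose C := [set y | connect e x y].
have cC y z : e y z -> (y \in C) = (z \in C) by exact: component_closed.
exists C; first by apply/imsetP; exists x.
rewrite ltNge; apply/negP => leC.
have ltC : #|C|%:R < delta * #|T|%:R.
  by rewrite ltNge; apply/negP => geC; move: (unbal C cC); rewrite geC leC.
have cAC y z : e y z -> (y \in A :|: C) = (z \in A :|: C).
  by move=> eyz; rewrite !finset.in_setU (cA _ _ eyz) (cC _ _ eyz).
have AC0 : [disjoint A & C].
  rewrite -setI_eq0; apply/eqP/setP => y; rewrite !inE; apply/negP => /andP[yA xy].
  by case/negP: xA; rewrite (closed_connect (a := mem A) _ xy) // => u v /cA.
have card_AC : #|A :|: C| = (#|A| + #|C|)%N.
  by rewrite cardsU (_ : A :&: C = finset.set0) ?cards0 ?subn0 //; apply/eqP; rewrite setI_eq0.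
have lt2 : #|A :|: C|%:R < 2 * delta * #|T|%:R by rewrite card_AC natrD; move: ltA ltC; lra.
have ltAC : #|A :|: C|%:R < delta * #|T|%:R.
  rewrite ltNge; apply/negP => geAC; move: (unbal _ cAC); rewrite geAC /= => /negP; apply.
  by rewrite (le_trans (ltW lt2)) // ler_wpM2r ?(ltW T0) //; move: d3; lra.
have : (#|A :|: C| <= #|A|)%N.
  apply: maxA; rewrite /small ltAC andbT; apply/forallP => y; apply/forallP => z.
  by apply/implyP => eyz; rewrite (cAC _ _ eyz).
rewrite card_AC -[leqRHS]addn0 leq_add2l leqn0 cards_eq0 => /eqP/setP/(_ x).
by rewrite !inE connect0.
Qed.

End Giant.

(** * Passage to the limit *)

Section Limit.
Variable R : realType.

Lemma prC (O : finType) (E : pred O) : (0 < #|O|)%N -> pr R E = 1 - pr R (predC E).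
Proof.
move=> O_gt0; apply/eqP; rewrite eq_sym subr_eq /pr -mulrDl -natrD.
rewrite (_ : [set w | predC E w] = ~: [set w | E w]); last by apply/setP => w; rewrite !inE.
by rewrite cardsC divff // pnatr_eq0 -lt0n.
Qed.

Definition giant (delta : R) (n : nat) : pred (outcome n) := fun w =>
  [exists C in components (kout_adj w), (1 - delta) * 2 ^+ n <= #|C|%:R].

(** Strictness lets [unique_giant] exclude a second component of size exactly [delta * 2 ^+ n] when
    [d = delta]. *)
Definition giant_lt (delta : R) (n : nat) : pred (outcome n) := fun w =>
  [exists C in components (kout_adj w), (1 - delta) * 2 ^+ n < #|C|%:R].

Lemma kout_prob_le1 n (E : pred (outcome n)) : (1 < n)%N -> kout_prob R 2 E <= 1.
Proof. by move=> n_gt1; rewrite kout_prob_pr // pr_le1. Qed.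

Lemma kout_prob_sub n (E F : pred (outcome n)) : (1 < n)%N -> subpred E F ->
  kout_prob R 2 E <= kout_prob R 2 F.
Proof. by move=> n_gt1 sEF; rewrite !kout_prob_pr // pr_sub // => p; exact: sEF. Qed.

Lemma kout_giant (delta eps : R) : 0 < delta -> delta <= 3^-1 -> 0 < eps ->
  exists n0 : nat, (1 < n0)%N /\ forall n, (n0 <= n)%N ->
  1 - eps <= kout_prob R 2 (@giant_lt delta n).
Proof.
move=> d0 d3 eps0; have d1 : delta < 1 by move: d3; lra.
have [D [n0 [n0_gt1 leD]]] := pr_balanced_cut d0 d1.
exists (n0 + Num.bound (`|D| / eps))%N; split=> [|n n_ge].
  by rewrite (leq_trans n0_gt1) ?leq_addr.
have n_gen0 : (n0 <= n)%N by rewrite (leq_trans _ n_ge) ?leq_addr.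
have n_gt1 : (1 < n)%N by rewrite (leq_trans n0_gt1).
have n_gt0 : (0 : R) < n%:R by rewrite ltr0n ltnW.
rewrite kout_prob_pr // prC; last first.
  rewrite card_prod !card_ffun muln_gt0 !expn_gt0 card_prod !card_ord muln_gt0.
  by move: n_gt1; case: (n) => [|[]].
rewrite lerB //; apply: (@le_trans _ _ (D / n%:R)); last first.
  rewrite ler_pdivrMr // (le_trans (ler_norm D)) // mulrC -ler_pdivrMr //.
  rewrite (le_trans (ltW (archi_boundP _))) ?divr_ge0 ?(ltW eps0) //.
  by rewrite ler_nat (leq_trans _ n_ge) ?leq_addl.
apply: le_trans (leD n n_gen0); apply: pr_sub => p /=; apply: contraR.
move=> /existsPn no_cut; apply/exists_inP.
have cube0 : (0 < #|cube n|)%N by rewrite card_cube expn_gt0.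
have [A cA|C CC ltC] := giant_component (@kout_adj_sym n (kout_of p)) d0 d3 cube0.
  have := no_cut A; rewrite (closed_saturated cA) /= /balanced.
  by rewrite card_cube natrX.
by exists C => //; move: ltC; rewrite card_cube natrX.
Qed.

Lemma cvg_to1 (p : nat -> R) :
    (exists n0 : nat, forall n, (n0 <= n)%N -> p n <= 1) ->
    (forall eps, 0 < eps -> exists n0 : nat, forall n, (n0 <= n)%N -> 1 - eps <= p n) ->
  (p @ \oo --> (1 : R))%classic.
Proof.
move=> [n1 le1] ge1; apply/cvgrPdist_le => eps eps0.
have [n0 ge] := ge1 _ eps0; exists (n0 + n1)%N => // n /= n_ge.
have h1 := le1 n (leq_trans (leq_addl _ _) n_ge).
have h0 := ge n (leq_trans (leq_addr _ _) n_ge).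
by rewrite ger0_norm ?subr_ge0 // lerBlDr addrC -lerBlDr.
Qed.

(** [d <= 1 - delta] makes the giant large enough to be counted; [d <= delta] leaves fewer than
    [delta * 2 ^+ n] vertices to any other component. *)
Lemma unique_giant (delta d : R) n (w : outcome n) :
    0 < delta -> d <= delta -> d <= 1 - delta -> giant_lt d w ->
  #|[set C in components (kout_adj w) | delta * 2 ^+ n <= #|C|%:R]| == 1%N.
Proof.
move=> delta0 d_le d_le' /exists_inP[C CC ltC]; apply/cards1P; exists C.
have N0 : (0 : R) < 2 ^+ n by rewrite exprn_gt0.
apply/setP => C'; rewrite !inE; apply/andP/eqP => [[C'C leC']|->]; last first.
  by split=> //; rewrite (le_trans _ (ltW ltC)) // ler_wpM2r ?(ltW N0) //; lra.
apply/eqP; apply: contraTT leC' => C'N; rewrite -ltNge.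
have dis := components_disjoint (@kout_adj_sym n w) C'C CC C'N.
have : (#|C'| + #|C| <= 2 ^ n)%N.
  rewrite -card_cube -cardsUI (_ : C' :&: C = finset.set0) ?cards0 ?addn0 ?max_card //.
  by apply/eqP; rewrite setI_eq0.
rewrite -(ler_nat R) natrD natrX => le_sum.
have : d * 2 ^+ n <= delta * 2 ^+ n by rewrite ler_wpM2r // ltW.
by move: le_sum ltC; rewrite mulrBl mul1r; lra.
Qed.

(** Diagonal extraction: [f n] is the largest [m <= n] with [p n m <= 1 / (m + 1)]. *)
Lemma eps_sequence (p : nat -> nat -> R) :
    (exists n0 : nat, forall n m, (n0 <= n)%N -> p n m <= 1) ->
    (forall m, exists n0 : nat, forall n, (n0 <= n)%N -> p n m <= m.+1%:R^-1) ->
  exists2 f : nat -> nat, (forall M, exists n0 : nat, forall n, (n0 <= n)%N -> (M <= f n)%N) &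
    exists n0 : nat, forall n, (n0 <= n)%N -> p n (f n) <= (f n).+1%:R^-1.
Proof.
move=> [n1 p1] pm.
exists (fun n => \max_(m < n.+1 | (p n m <= m.+1%:R^-1)%R) m)%N.
  move=> M; have [n0 pM] := pm M; exists (n0 + M)%N => n n_ge.
  have Mn : (M < n.+1)%N by rewrite ltnS (leq_trans (leq_addl _ _) n_ge).
  apply: (@leq_bigmax_cond _ (fun m : 'I_n.+1 => p n m <= m.+1%:R^-1) val (Ordinal Mn)) => /=.
  by rewrite pM // (leq_trans (leq_addr _ _) n_ge).
exists n1 => n n_ge.
(* The index 0 qualifies since [p n 0 <= 1], so the maximum is attained. *)
have P0 : (0 < #|[pred m : 'I_n.+1 | (p n m <= m.+1%:R^-1)%R]|)%N.
  by apply/card_gt0P; exists ord0; rewrite inE invr1 p1.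
by have [m + ->] := eq_bigmax_cond val P0; rewrite inE.
Qed.

End Limit.

Theorem theorem1p2 (R : realType) :
  (exists eps : nat -> R,
     (eps @ \oo --> (0 : R))%classic /\
     whp_kout R 2 (fun (n : nat) (w : outcome n) =>
       [exists C in components (kout_adj w),
          (1 - eps n) * 2 ^+ n <= #|C|%:R])) /\
  (forall delta : R, 0 < delta -> delta < 1 ->
     whp_kout R 2 (fun (n : nat) (w : outcome n) =>
       #|[set C in components (kout_adj w) |
            delta * 2 ^+ n <= #|C|%:R]| == 1%N)).
Proof.
split; last first.
  move=> delta delta0 delta1; apply: cvg_to1.
    by exists 2%N => n; exact: kout_prob_le1.
  move=> eps eps0; pose d := Num.min (3^-1) (Num.min delta (1 - delta)).
  have d0 : 0 < d by rewrite !lt_min invr_gt0 delta0 subr_gt0 delta1 ltr0n.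
  have d3 : d <= 3^-1 by rewrite ge_min lexx.
  have [n0 [n0_gt1 ge]] := kout_giant d0 d3 eps0; exists n0 => n n_ge.
  apply: (le_trans (ge n n_ge)); apply: kout_prob_sub => [|w]; first exact: leq_trans n_ge.
  by apply: unique_giant => //; rewrite !ge_min lexx ?orbT.
have giant_prob (m : nat) (eps : R) : 0 < eps ->
    exists n0 : nat, (1 < n0)%N /\ forall n, (n0 <= n)%N ->
    1 - eps <= kout_prob R 2 (@giant R (m.+1%:R^-1) n).
  move=> eps0; pose d : R := m.+3%:R^-1.
  have d0 : 0 < d by rewrite invr_gt0 ltr0n.
  have d3 : d <= 3^-1 by rewrite lef_pV2 ?posrE ?ltr0n // ler_nat.
  have [n0 [n0_gt1 ge]] := kout_giant d0 d3 eps0; exists n0; split=> // n n_ge.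
  apply: (le_trans (ge n n_ge)); apply: kout_prob_sub => [|w]; first exact: leq_trans n_ge.
  case/exists_inP => C CC ltC; apply/exists_inP; exists C => //.
  rewrite (le_trans _ (ltW ltC)) // ler_wpM2r ?exprn_ge0 // lerB //.
  by rewrite lef_pV2 ?posrE ?ltr0n // ler_nat leqW.
(* The failure probability at density loss [1 / (m + 1)]; [eps_sequence] lets [m] grow with [n]
   slowly enough that both vanish. *)
pose p (n m : nat) := 1 - kout_prob R 2 (@giant R (m.+1%:R^-1) n).
have p1 : exists n0 : nat, forall n m, (n0 <= n)%N -> p n m <= 1.
  exists 2%N => n m n_gt1; rewrite gerBl kout_prob_pr //; exact: pr_ge0.
have pm m : exists n0 : nat, forall n, (n0 <= n)%N -> p n m <= m.+1%:R^-1.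
  have e0 : (0 : R) < m.+1%:R^-1 by rewrite invr_gt0 ltr0n.
  have [n0 [_ ge]] := giant_prob m _ e0; exists n0 => n /ge.
  by rewrite /p => h; rewrite lerBlDr addrC -lerBlDr.
have [f f_oo [n1 pf]] := eps_sequence p1 pm.
have f_small (eps : R) : 0 < eps -> exists n0 : nat, forall n, (n0 <= n)%N -> (f n).+1%:R^-1 <= eps.
  move=> eps0; have [n0 fM] := f_oo (Num.bound eps^-1); exists n0 => n /fM leM.
  rewrite -[leRHS]invrK lef_pV2 ?posrE ?invr_gt0 ?ltr0n //.
  by rewrite (le_trans (ltW (archi_boundP _))) ?invr_ge0 ?(ltW eps0) // ler_nat leqW.
exists (fun n => (f n).+1%:R^-1); split.
  apply/cvgrPdist_le => eps eps0; have [n0 le_eps] := f_small _ eps0.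
  exists n0 => // n /= n_ge; rewrite sub0r normrN ger0_norm ?le_eps //.
apply: cvg_to1; first by exists 2%N => n; exact: kout_prob_le1.
move=> eps eps0; have [n0 le_eps] := f_small _ eps0; exists (n0 + n1)%N => n n_ge.
have le_p := pf n (leq_trans (leq_addl _ _) n_ge).
apply: (@le_trans _ _ (1 - (f n).+1%:R^-1)).
  by rewrite lerB // le_eps // (leq_trans (leq_addr _ _) n_ge).
by rewrite lerBlDr addrC -lerBlDr; exact: le_p.
Qed.
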